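(* Let $(\varphi,\psi)$ be a pair of kernels with $M_0(\psi)<+\infty$, let $\eta$ be a convex $\varphi$-function, and let $f\in L^\eta(\mathbb{R})$ be fixed. Then there exists $\lambda>0$ such that $$\lim_{w\to+\infty}I^\eta[\lambda(S_w^{\varphi,\psi}f-f)]=0.$$
   Context: For $g:\mathbb{R}\to\mathbb{R}$ and $\nu\ge 0$ put $$M_\nu(g):=\sup_{u\in\mathbb{R}}\sum_{k\in\mathbb{Z}}|g(u-k)|\,|u-k|^\nu,$$ so that $M_0(g)=\sup_{u}\sum_{k}|g(u-k)|$. A pair of kernels $(\varphi,\psi)$ is a pair of functions $\varphi,\psi:\mathbb{R}\to\mathbb{R}$ in $L^1(\mathbb{R})$ such that: $\varphi$ is bounded in a neighborhood of the origin; $\sum_{k\in\mathbb{Z}}\varphi(u-k)=1$ for every $u\in\mathbb{R}$; $\int_{\mathbb{R}}\psi(u)\,du=1$; and there exists $r>0$ with $M_r(\varphi)<+\infty$. The Durrmeyer sampling operators are, for $w>0$ and any $f$ for which the series converges for every $x$, $$(S_w^{\varphi,\psi}f)(x)=\sum_{k\in\mathbb{Z}}\varphi(wx-k)\,w\int_{\mathbb{R}}\psi(wu-k)f(u)\,du,\qquad x\in\mathbb{R}.$$ A convex $\varphi$-function (standard terminology, unrelated to the kernel $\varphi$) is a convex function $\eta:[0,\infty)\to[0,\infty)$ with $\eta(0)=0$ and $\eta(u)>0$ for every $u>0$. For $f\in M(\mathbb{R})$, the space of Lebesgue measurable real functions on $\mathbb{R}$, put $I^\eta[f]:=\int_{\mathbb{R}}\eta(|f(x)|)\,dx$.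 The Orlicz space is $L^\eta(\mathbb{R})=\{f\in M(\mathbb{R}): I^\eta[\lambda f]<+\infty\text{ for some }\lambda>0\}$. *)

(* Defs.v *)
From HB Require Import structures.
From mathcomp Require Import all_boot all_order all_algebra.
From mathcomp Require Import all_classical all_reals all_analysis.

Set Implicit Arguments.
Unset Strict Implicit.
Unset Printing Implicit Defensive.
Import Order.TTheory GRing.Theory Num.Theory.
Import numFieldNormedType.Exports.
Local Open Scope classical_set_scope.
Local Open Scope ring_scope.

(* The real line with the sigma-algebra of Lebesgue (not only Borel)
   measurable sets: the domain of [completed_lebesgue_measure]. *)
Notation lebR R :=
  (caratheodory_type (mu_ext (@wlength R (@idfun (measurableTypeR R))))).

Section TwoSidedSeries.
Context {R : realType}.
Implicit Types a : int -> R.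

(* [Negz n] is the integer -(n+1). *)
Definition cvg_sumZ a : Prop :=
  cvgn (series (fun n : nat => a (Posz n))) /\
  cvgn (series (fun n : nat => a (Negz n))).

Definition sumZ a : R :=
  limn (series (fun n : nat => a (Posz n))) +
  limn (series (fun n : nat => a (Negz n))).

End TwoSidedSeries.

Section Durrmeyer.
Context {R : realType}.
Implicit Types (g phi psi f eta : R -> R) (nu w x : R).

Local Notation leb := (@completed_lebesgue_measure R).

(* Since [0 `^ 0 = 1], [abs_moment 0 g] is the supremum of the sums of
   [|g (u - k)|]. *)
Definition abs_moment nu g : \bar R :=
  ereal_sup (range (fun u : R =>
    \esum_(k in [set: int])
      (`|g (u - k%:~R)| * `|u - k%:~R| `^ nu)%:E)).

Definition in_L1 g : Prop :=
  leb.-integrable [set: lebR R] (EFin \o g).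

Definition kernel_pair phi psi : Prop :=
  [/\ in_L1 phi /\ in_L1 psi,
      bounded_near phi (nbhs (0 : R)),
      (forall u : R, cvg_sumZ (fun k => phi (u - k%:~R)) /\
                     sumZ (fun k => phi (u - k%:~R)) = 1),
      \int[leb]_u psi u = 1 &
      exists2 r : R, 0 < r & (abs_moment r phi < +oo)%E].

Definition durrmeyer_term phi psi w f x (k : int) : R :=
  phi (w * x - k%:~R) * (w * \int[leb]_u (psi (w * u - k%:~R) * f u)).

Definition durrmeyer phi psi w f x : R :=
  sumZ (durrmeyer_term phi psi w f x).

(* [Rintegral] and [limn] are total, so the domain of the operator has to be
   stated separately. *)
Definition durrmeyer_dom phi psi w : set (R -> R) :=
  [set f | (forall k : int, in_L1 (fun u => psi (w * u - k%:~R) * f u)) /\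
           (forall x, cvg_sumZ (durrmeyer_term phi psi w f x))].

(* Only the values of [eta] on [0, +oo[ matter; [0 <= eta] there follows from
   the last two clauses. *)
Definition convex_phi_function eta : Prop :=
  [/\ convex_function (`[0, +oo[%classic : set R) eta,
      eta 0 = 0 &
      forall u, 0 < u -> 0 < eta u].

Definition modular eta f : \bar R :=
  (\int[leb]_x (eta `|f x|)%:E)%E.

Definition orlicz_space eta : set (R -> R) :=
  [set f | measurable_fun [set: lebR R] f /\
           exists2 lambda : R, 0 < lambda &
             (modular eta (fun x => (lambda * f x)%R) < +oo)%E].

End Durrmeyer.

(* Main.v *)
Require Import Defs.
From mathcomp Require Import all_boot all_order all_algebra.
From mathcomp Require Import all_classical all_reals all_analysis.
From mathcomp Require Import measurable_realfun zify ring lra.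

(** Put K_w(x, u) = sum_k |phi(w x - k)| w |psi(w u - k)|. Because the
    translates of [phi] sum to 1 and [psi] has integral 1, the difference
    S_w f - f at x is the integral over u of a signed kernel, dominated by
    K_w(x, u), against f(u) - f(x); hence
    |S_w f - f|(x) <= int K_w(x, u) |f(u) - f(x)| du
    ([durrmeyer_deviation_le]). The two marginals of K_w are bounded
    uniformly in w, by A = M_0(phi) ||psi||_1 and B = ||phi||_1 M_0(psi); the
    moment of [phi] of positive order enters through
    [translates_bounded_moment], which makes M_0(phi) finite. Jensen's
    inequality for a weight of mass at most A ([phi_function_jensen]) then
    reduces the theorem to the convergence to 0 of the double integral of
    K_w(x, u) eta(c |f(u) - f(x)|), for one c > 0.

    Replace f by a simple function s close to it in modular
    ([modular_simple_approx]). As [eta] is monotone, eta(c |f(u) - f(x)|) is at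
    most a function of u with small integral, plus a function of x with small
    integral, plus a multiple of the sum, over the finitely many level sets E
    of s off 0, of |1_E(u) - 1_E(x)|. The first two terms cost the marginals of
    K_w, so what remains is that K_w asymptotically transfers no mass between a
    set E of finite measure and its complement. This is the content of
    [modular_approximation].

    The transfer is stable under approximation of E in measure, again by the
    bounds on the marginals, so E may be taken to be a finite union of
    intervals, and then one interval ([no_leak_approx], [no_leakU]). For an
    interval, K_w factors through k: mass that goes from x to u across the
    boundary crosses it either between x and k / w or between k / w and u.
    Substituting w u = k + s, the second case has total mass at most
    w^-1 int |psi(s)| N_w(s) ds, where N_w(s) counts the integers that the
    shift by s carries across an endpoint of an interval of length of order w.
    Since N_w(s) is at most linear in |s| and at most of order w, this tends to
    0 ([esum_int_itv_shift_le], [deviation_cvg0]).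

    Every function on which the kernel is tested has the form P(x) Q(u), so
    the double integrals are series over k of products of two one-variable
    integrals ([transfer]). The part of the argument that does not mention the
    line is carried out on an arbitrary measure space, for two families of
    weights. *)

Set Implicit Arguments.
Unset Strict Implicit.
Unset Printing Implicit Defensive.
Import Order.TTheory GRing.Theory Num.Theory.
Import numFieldNormedType.Exports.
Local Open Scope classical_set_scope.
Local Open Scope ring_scope.

(** * Convex phi-functions *)

Section ConvexPhiFunction.
Context {R : realType} (eta : R -> R).
Hypothesis heta : convex_phi_function eta.

Let eta0 : eta 0 = 0. Proof. by case: heta. Qed.

Lemma phi_function_convex (t a b : R) : 0 <= t <= 1 -> 0 <= a -> 0 <= b ->
  eta (t * a + (1 - t) * b) <= t * eta a + (1 - t) * eta b.
Proof.
move=> /andP[t0 t1] a0 b0; case: heta => hc _ _.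
have t01 : Itv.spec (@Itv.num_sem R) (Itv.Real `[0%Z, 1%Z]%R) t.
  by apply/andP; split; [exact: num_real|rewrite /= in_itv/= t0 t1].
have memI (x : R) : 0 <= x -> x \in (`[0, +oo[%classic : set R).
  by move=> x0; rewrite inE/= in_itv/= x0.
exact: (hc (Itv.mk t01) a b (memI _ a0) (memI _ b0)).
Qed.

Lemma phi_function_ge0 (u : R) : 0 <= u -> 0 <= eta u.
Proof.
rewrite le_eqVlt => /predU1P[<-|u0]; first by rewrite eta0.
by case: heta => _ _ /(_ _ u0)/ltW.
Qed.

Lemma phi_function_scale (t u : R) : 0 <= t <= 1 -> 0 <= u ->
  eta (t * u) <= t * eta u.
Proof.
move=> t01 u0; have := @phi_function_convex _ _ 0 t01 u0 (lexx _).
by rewrite mulr0 addr0 eta0 mulr0 addr0.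
Qed.

Lemma phi_function_le (a b : R) : 0 <= a -> a <= b -> eta a <= eta b.
Proof.
move=> a0 ab; have b0 := le_trans a0 ab.
have [b00|bN0] := eqVneq b 0.
  by have -> : a = b by apply/eqP; rewrite eq_le ab b00 a0.
have bp : 0 < b by rewrite lt_neqAle eq_sym bN0.
have t01 : 0 <= a / b <= 1 by rewrite divr_ge0// ler_pdivrMr// mul1r.
have := phi_function_scale t01 b0; rewrite divfK// => /le_trans; apply.
have /andP[_ ?] := t01.
by rewrite ler_piMl// phi_function_ge0.
Qed.

(** This is what embeds the Orlicz space in the sum of L^1 and L^oo. It holds
    because [eta u / u] is nondecreasing. *)
Lemma phi_function_linear_growth (u : R) : 0 <= u -> u <= 1 + eta u / eta 1.
Proof.
move=> u0; have e1 : 0 < eta 1 by case: heta => _ _; exact.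
have [u1|/ltW u1] := leP u 1.
  by rewrite (le_trans u1)// lerDl divr_ge0 ?phi_function_ge0// ltW.
have up : 0 < u by exact: lt_le_trans u1.
have t01 : 0 <= u^-1 <= 1 by rewrite invr_ge0 u0 invf_le1.
have := phi_function_scale t01 u0; rewrite mulVf ?gt_eqF// => h.
apply: ler_wpDl => //.
by rewrite ler_pdivlMr// -ler_pdivlMl.
Qed.

(** By monotonicity alone: the sum is at most three times its largest term. *)
Lemma phi_function_add3 (a b c : R) : 0 <= a -> 0 <= b -> 0 <= c ->
  eta (a + b + c) <= eta (3 * a) + eta (3 * b) + eta (3 * c).
Proof.
move=> a0 b0 c0.
have ge (x : R) : 0 <= x -> 0 <= eta (3 * x).
  by move=> x0; rewrite phi_function_ge0// mulr_ge0.
have := ge _ a0; have := ge _ b0; have := ge _ c0 => c1 b1 a1.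
have s0 : 0 <= a + b + c by rewrite !addr_ge0.
have [ca|ca] := leP (a + b + c) (3 * a).
  have := phi_function_le s0 ca; lra.
have [cb|cb] := leP (a + b + c) (3 * b).
  have := phi_function_le s0 cb; lra.
have cc : a + b + c <= 3 * c by lra.
have := phi_function_le s0 cc; lra.
Qed.

Let slopes (s t r : R) : 0 <= s -> s < t -> t < r ->
  (eta t - eta s) / (t - s) <= (eta r - eta t) / (r - t).
Proof.
move=> s0 st tr.
have rs : 0 < r - s by lra.
have ts : 0 < t - s by lra.
have rt : 0 < r - t by lra.
have p01 : 0 <= (r - t) / (r - s) <= 1.
  by rewrite divr_ge0 ?(ltW rt) ?(ltW rs)//= ler_pdivrMr// mul1r; lra.
have r0 : 0 <= r by lra.
have := phi_function_convex p01 s0 r0.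
have -> : (r - t) / (r - s) * s + (1 - (r - t) / (r - s)) * r = t.
  by field; lra.
have -> : (r - t) / (r - s) * eta s + (1 - (r - t) / (r - s)) * eta r =
  ((r - t) * eta s + (t - s) * eta r) / (r - s) by field; lra.
rewrite ler_pdivlMr// => h.
by rewrite ler_pdivrMr// mulrAC ler_pdivlMr//; nra.
Qed.

(** Supporting line at [t], whose slope is the supremum of the slopes of the
    chords that end at [t]; they are bounded by those that start there. *)
Lemma phi_function_support (t : R) : 0 <= t ->
  exists2 m : R, 0 <= m & forall s, 0 <= s -> eta t + m * (s - t) <= eta s.
Proof.
rewrite le_eqVlt => /predU1P[<-|t0].
  by exists 0 => // s s0; rewrite eta0 mul0r addr0 phi_function_ge0.
pose S := [set (eta t - eta s) / (t - s) | s in [set s | 0 <= s < t]].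
have S0 : S (eta t / t) by exists 0; rewrite /= ?lexx ?t0// eta0 !subr0.
have ubS (r : R) : t < r -> ubound S ((eta r - eta t) / (r - t)).
  by move=> tr _ [s /= /andP[s0 st] <-]; exact: slopes.
have supS : has_sup S.
  split; first by exists (eta t / t).
  by exists ((eta (t + 1) - eta t) / (t + 1 - t)); apply: ubS; rewrite ltrDl.
exists (sup S).
  apply: le_trans (ub_le_sup _ S0); last by case: supS.
  by rewrite divr_ge0 ?phi_function_ge0// ltW.
move=> s s0; have [st|ts|->] := ltgtP s t; last by rewrite subrr mulr0 addr0.
- have ts : 0 < t - s by rewrite subr_gt0.
  have : (eta t - eta s) / (t - s) <= sup S.
    by apply: ub_le_sup; [case: supS|exists s => //=; rewrite s0].
  rewrite ler_pdivrMr// => h.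
  lra.
- have st : 0 < s - t by rewrite subr_gt0.
  have : sup S <= (eta s - eta t) / (s - t).
    by apply: ge_sup; [case: supS|exact: ubS].
  rewrite ler_pdivlMr// => h; lra.
Qed.

Lemma measurable_phi_function d (T : measurableType d) (g : T -> R) :
  measurable_fun setT g -> (forall x, 0 <= g x) ->
  measurable_fun setT (eta \o g).
Proof.
move=> mg g0.
have -> : eta \o g = (fun t => eta (Num.max 0 t)) \o g.
  by apply/funext => x /=; rewrite max_r.
apply: measurableT_comp => //.
apply: nondecreasing_measurable => // s t st.
apply: phi_function_le; first by rewrite le_max lexx.
by rewrite ge_max !le_max lexx st orbT.
Qed.

Lemma phi_function_cvg0 (v : nat -> R) : (forall n, 0 <= v n) ->
  v @ \oo --> (0 : R) -> (eta \o v) @ \oo --> (0 : R).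
Proof.
move=> v0 vc.
apply: (@squeeze_cvgr _ _ _ _ (cst 0) (fun n => v n * eta 1)).
- have : \forall n \near \oo, v n <= 1 by apply: (cvgr_le _ vc); exact: ltr01.
  apply: filterS => n vn1; rewrite phi_function_ge0//=.
  by have := @phi_function_scale (v n) 1; rewrite v0 vn1 mulr1; apply.
- exact: cvg_cst.
- by rewrite -[X in _ --> X](mul0r (eta 1)); apply: cvgMr_tmp => //; exact: cvg_cst.
Qed.

Local Open Scope ereal_scope.

(** Jensen's inequality for a weight of mass at most [A]: integrate against
    the weight the supporting line of [eta] at [t]. Its value at the origin is
    nonpositive because [eta 0 = 0], so a mass smaller than [A] only helps. *)
Lemma phi_function_jensen d (T : measurableType d)
    (mu : {measure set T -> \bar R}) (K : T -> \bar R) (g : T -> R) (A t : R) :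
  measurable_fun setT K -> (forall u, 0 <= K u) -> (0 < A)%R ->
  \int[mu]_u K u <= A%:E ->
  measurable_fun setT g -> (forall u, 0 <= g u)%R ->
  (0 <= t)%R -> t%:E <= \int[mu]_u (K u * (g u)%:E) ->
  (A * eta t)%:E <= \int[mu]_u (K u * (eta (A * g u))%:E).
Proof.
move=> mK K0 A0 KA mg g0 t0 tK.
have [m m0 supp] := phi_function_support t0.
pose c := (m * t - eta t)%R.
have c0 : (0 <= c)%R.
  by have := supp 0%R (lexx _); rewrite /c eta0 sub0r mulrN; lra.
have mg' : measurable_fun setT (EFin \o g) by exact/measurable_EFinP.
have mKg : measurable_fun setT (fun u => K u * (g u)%:E).
  exact: emeasurable_funM.
have Ag0 u : (0 <= A * g u)%R by rewrite mulr_ge0// ltW.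
have meta : measurable_fun setT (fun u => (eta (A * g u))%:E).
  apply/measurable_EFinP; apply: (measurable_phi_function (g := fun u => A * g u)%R) => //.
  exact: measurable_funM.
have mKe : measurable_fun setT (fun u => K u * (eta (A * g u))%:E).
  exact: emeasurable_funM.
have Ke0 u : 0 <= K u * (eta (A * g u))%:E.
  by rewrite mule_ge0// lee_fin phi_function_ge0.
have key : (m * A)%:E * \int[mu]_u (K u * (g u)%:E) <=
    \int[mu]_u (K u * (eta (A * g u))%:E) + c%:E * \int[mu]_u K u.
  rewrite -ge0_integralZl//; last 2 first.
  - by move=> u _; rewrite mule_ge0// lee_fin.
  - by rewrite lee_fin mulr_ge0// ltW.
  rewrite -[X in _ <= _ + X]ge0_integralZl// -ge0_integralD//; last 2 first.
  - by move=> u _; rewrite mule_ge0.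
  - exact: emeasurable_funM.
  apply: ge0_le_integral => //.
  - move=> u _; rewrite mule_ge0// ?mule_ge0// ?lee_fin//.
    by rewrite mulr_ge0// ltW.
  - exact: emeasurable_funM.
  - by apply: emeasurable_funD => //; exact: emeasurable_funM.
  move=> u _; rewrite muleCA -[X in _ <= _ + X]muleC -ge0_muleDr ?lee_fin//.
  - rewrite -EFinM -EFinD lee_wpmul2l// lee_fin.
    by have := supp _ (Ag0 u); rewrite /c; lra.
  - exact: phi_function_ge0.
rewrite -(leeD2rE (x := (c * A)%:E))//.
apply: (@le_trans _ _ (\int[mu]_u (K u * (eta (A * g u))%:E) +
    c%:E * \int[mu]_u K u)); last first.
  by rewrite leeD2l// EFinM lee_wpmul2l// lee_fin.
apply: le_trans key.
apply: (@le_trans _ _ ((m * A)%:E * t%:E)); last first.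
  by rewrite lee_wpmul2l// lee_fin mulr_ge0// ltW.
by rewrite -EFinD -EFinM lee_fin /c; lra.
Qed.

End ConvexPhiFunction.

(** * Affine changes of variable for the completed Lebesgue measure *)

Section AffineChangeOfVariable.
Context {R : realType}.
Local Notation leb := (@completed_lebesgue_measure R).
Implicit Types (w c : R).

Definition affine_map w c : lebR R -> lebR R := fun x => (w * x + c)%R.
Let affine_preimage_itv w c (a b : R) : 0 < w ->
  (fun x : R => w * x + c)%R @^-1` `]a, b]%classic =
  `](a - c) / w, (b - c) / w]%classic.
Proof.
move=> w0; apply/seteqP; split=> x /=; rewrite !in_itv/= => /andP[ax xb].
  by rewrite ltr_pdivrMr// ler_pdivlMr// ltrBlDr lerBrDr mulrC ax xb.
move: ax xb; rewrite ltr_pdivrMr// ler_pdivlMr// ltrBlDr lerBrDr mulrC => -> ->.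
by [].
Qed.

Local Open Scope ereal_scope.

Let affine_preimage_wlength w c (X : set (ocitv_type R)) : (0 < w)%R ->
  ocitv X ->
  ocitv ((fun x : R => w * x + c)%R @^-1` X) /\
  wlength (@idfun (measurableTypeR R))
    ((fun x : R => w * x + c)%R @^-1` X : set (ocitv_type R)) =
  (w^-1)%:E * wlength (@idfun (measurableTypeR R)) X.
Proof.
move=> w0 [[a b] _ <-] /=; rewrite affine_preimage_itv//; split.
  exact: is_ocitv.
rewrite !wlength_itv/= !lte_fin ltr_pM2r ?invr_gt0// ltrD2r.
case: ifPn => ab; last by rewrite mule0.
by rewrite -!EFinB -EFinM; congr EFin; field; rewrite gt_eqF.
Qed.

(** Pulling back a cover by half-open intervals gives such a cover. *)
Let affine_preimage_le w c (X : set R) : (0 < w)%R ->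
  leb ((fun x : R => w * x + c)%R @^-1` X) <= (w^-1)%:E * leb X.
Proof.
move=> w0; rewrite lee_pdivlMl//.
rewrite /completed_lebesgue_measure /completed_lebesgue_stieltjes_measure.
rewrite /completed_measure_extension.
apply: le_ereal_inf_tmp => _ [F [mF XF] <-].
rewrite -lee_pdivlMl// -nneseriesZl; last by move=> i _; exact: wlength_ge0.
apply: ereal_inf_lbound => /=.
exists (fun i => (fun x : R => w * x + c)%R @^-1` F i).
  split.
    by move=> i; have [] := affine_preimage_wlength c w0 (mF i).
  by move=> x /XF [i _ Fi]; exists i.
apply: eq_eseriesr => i _.
by have [_ ->] := affine_preimage_wlength c w0 (mF i).
Qed.

(** For the outer measure, hence for every set; the reverse inequality is the
    direct one for the inverse map. *)
Lemma completed_lebesgue_affine w c (X : set R) : (0 < w)%R ->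
  leb ((fun x : R => w * x + c)%R @^-1` X) = (w^-1)%:E * leb X.
Proof.
move=> w0; apply/eqP; rewrite eq_le affine_preimage_le//=.
rewrite lee_pdivrMl//.
have wi : (0 < w^-1)%R by rewrite invr_gt0.
have := @affine_preimage_le w^-1 (- c / w) ((fun x : R => w * x + c)%R @^-1` X) wi.
rewrite invrK; apply: le_trans.
rewrite [X in _ <= leb X](_ : _ = X)//; apply/funext => x /=; congr X.
by field; rewrite gt_eqF.
Qed.

(** Caratheodory's criterion is invariant because the map scales the outer
    measure of all sets by the same factor. *)
Lemma measurable_affine w c : (0 < w)%R -> measurable_fun setT (affine_map w c).
Proof.
move=> w0 _ Y mY; rewrite setTI.
have wi : (0 < w^-1)%R by rewrite invr_gt0.
(* [Z] is the preimage, by the affine map, of its preimage by the inverse map. *)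
have bw (Z : set R) : leb Z =
    (w^-1)%:E * leb ((fun x : R => w^-1 * x + (- c / w))%R @^-1` Z).
  rewrite completed_lebesgue_affine// invrK muleA -EFinM mulVf ?gt_eqF//.
  by rewrite mul1e.
move=> Z.
change (leb Z = leb (Z `&` affine_map w c @^-1` Y) +
   leb (Z `&` ~` (affine_map w c @^-1` Y))).
rewrite [LHS]bw [X in X + _]bw [X in _ + X]bw -ge0_muleDr//.
congr (_ * _); rewrite [LHS]mY.
congr (_ + _); congr (leb _); apply/funext => x /=; congr (_ /\ _).
  by rewrite /affine_map; congr Y; field; rewrite gt_eqF.
by rewrite /affine_map; congr (~ Y _); field; rewrite gt_eqF.
Qed.

Lemma ge0_integral_affine w c (h : R -> \bar R) : (0 < w)%R ->
  measurable_fun [set: lebR R] h -> (forall x, 0 <= h x) ->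
  \int[leb]_x h (w * x + c)%R = (w^-1)%:E * \int[leb]_x h x.
Proof.
move=> w0 mh h0.
have m0 := measurable_affine c w0.
have wi0 : (0 <= w^-1)%R by rewrite invr_ge0 ltW.
have := @ge0_integral_pushforward _ _ _ _ _ _ m0 leb setT h measurableT mh (fun y _ => h0 y).
rewrite preimage_setT => <-.
rewrite -(@ge0_integral_mscale _ _ _ leb setT measurableT (NngNum wi0))//.
apply: eq_measure_integral => A mA _.
exact: completed_lebesgue_affine.
Qed.

End AffineChangeOfVariable.

(** * Series over the integers *)

Section SumsOverIntegers.
Context {R : realType}.
Implicit Types a b : int -> R.

(** An enumeration of the integers: theorems exchanging sums and integrals are
    about series indexed by [nat]. *)
Definition int_of_index (n : nat) : int :=
  if odd n then Negz n./2 else Posz n./2.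

Lemma int_of_index_bij : set_bij [set: nat] [set: int] int_of_index.
Proof.
split=> //.
- move=> m n _ _; rewrite /int_of_index.
  have := odd_double_half m; have := odd_double_half n.
  by case: (odd m); case: (odd n) => // mE nE [mn]; rewrite -mE -nE mn.
- move=> [n|n] _ /=; [exists n.*2|exists n.*2.+1] => //.
    by rewrite /int_of_index odd_double doubleK.
  by rewrite /int_of_index/= odd_double/= uphalf_double.
Qed.

Local Open Scope ereal_scope.

Lemma esum_int_of_index (F : int -> \bar R) : (forall k, 0 <= F k) ->
  \esum_(k in [set: int]) F k = \sum_(n <oo) F (int_of_index n).
Proof.
by move=> F0; rewrite (reindex_esum _ _ _ _ int_of_index_bij) nneseries_esumT.
Qed.

Lemma esum_int_split (F : int -> \bar R) : (forall k, 0 <= F k) ->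
  \esum_(k in [set: int]) F k =
  \sum_(n <oo) F (Posz n) + \sum_(n <oo) F (Negz n).
Proof.
move=> F0; rewrite (esumID (range Posz))// !setTI; congr (_ + _).
  by rewrite esum_image ?nneseries_esumT// => m n _ _ [].
have -> : ~` range Posz = range Negz.
  apply/seteqP; split=> [[n|n] /=|_ [n _ <-] [m _]//].
    by move=> /(_ (ex_intro2 _ _ n I erefl)).
  by exists n.
by rewrite esum_image ?nneseries_esumT// => m n _ _ [].
Qed.

Let series_abs_le (u : nat -> R) : \sum_(n <oo) `|u n|%:E < +oo ->
  cvgn (series u) /\ `|limn (series u)|%:E <= \sum_(n <oo) `|u n|%:E.
Proof.
move=> uoo; have cn : cvgn [normed series u]%R.
  exact: (@nnseries_is_cvg R (fun n => `|u n|)%R).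
split; first exact: normed_cvg.
have := lim_series_norm cn; rewrite -lee_fin => /le_trans; apply.
rewrite -EFin_lim// le_eqVlt; apply/predU1P; left; congr (limn _).
by apply/funext => n /=; rewrite sumEFin.
Qed.

Lemma cvg_sumZ_abs a : \esum_(k in [set: int]) `|a k|%:E < +oo -> cvg_sumZ a.
Proof.
rewrite esum_int_split// => h.
split.
- apply: (series_abs_le (u := a \o Posz) _).1; apply: le_lt_trans h.
  by rewrite leeDl// nneseries_ge0.
- apply: (series_abs_le (u := a \o Negz) _).1; apply: le_lt_trans h.
  by rewrite leeDr// nneseries_ge0.
Qed.

Lemma abs_sumZ_le a : `|sumZ a|%:E <= \esum_(k in [set: int]) `|a k|%:E.
Proof.
have [h|h] := ltP (\esum_(k in [set: int]) `|a k|%:E) +oo; last first.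
  by rewrite (le_trans _ h)// leey.
move: h; rewrite esum_int_split// => h.
apply: (@le_trans _ _ (`|limn (series (fun n : nat => a (Posz n)))|%:E +
   `|limn (series (fun n : nat => a (Negz n)))|%:E)).
  by rewrite -EFinD lee_fin ler_normD.
apply: leeD.
- apply: (series_abs_le (u := a \o Posz) _).2; apply: le_lt_trans h.
  by rewrite leeDl// nneseries_ge0.
- apply: (series_abs_le (u := a \o Negz) _).2; apply: le_lt_trans h.
  by rewrite leeDr// nneseries_ge0.
Qed.

Lemma sumZB a b (t : R) : cvg_sumZ a -> cvg_sumZ b ->
  sumZ (fun k => a k - b k * t)%R = (sumZ a - sumZ b * t)%R.
Proof.
move=> [ap an] [bp bn]; rewrite /sumZ.
have lim (u v : nat -> R) : cvgn (series u) -> cvgn (series v) ->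
    limn (series (fun n => u n - v n * t)%R) =
    (limn (series u) - limn (series v) * t)%R.
  move=> cu cv.
  have -> : (fun n => u n - v n * t)%R = (u + - (t *: v))%R.
    by apply/funext => n; rewrite /= mulrC.
  rewrite lim_seriesB//; last exact: is_cvg_seriesZ.
  by rewrite lim_seriesZ// mulrC.
by rewrite !lim//; ring.
Qed.

End SumsOverIntegers.

(** * Integers near the endpoints of an interval *)

Section Counting.
Context {R : realType}.
Local Open Scope ereal_scope.

Lemma esum_int_itv_le (alpha beta : R) : (alpha <= beta)%R ->
  \esum_(k in [set: int]) (\1_`]alpha, beta]%classic (k%:~R : R))%:E <=
  (beta - alpha + 1)%:E.
Proof.
move=> ab; pose m := Num.floor alpha; pose n := `|Num.floor beta - m|%N.
have mb : (m <= Num.floor beta)%R by exact: le_floor.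
have nE : (n%:Z = Num.floor beta - m)%R by rewrite /n gez0_abs// subr_ge0.
(* The integers of the interval are [m + 1, ..., m + n]. *)
pose e (i : nat) : int := (m + 1 + i%:Z)%R.
have einj : set_inj `I_n e by move=> i j _ _ /addrI [].
have SE : [set k : int | (alpha < k%:~R <= beta)%R] = e @` `I_n.
  apply/seteqP; split=> [k /= /andP[ak kb]|_ [i /= iN <-]].
    have mk : (m < k)%R by rewrite floor_lt_int.
    have kM : (k <= Num.floor beta)%R by rewrite floor_ge_int.
    exists `|(k - m - 1)%R|%N.
      rewrite -ltz_nat nE gez0_abs; last by lia.
      by lia.
    by rewrite /e gez0_abs; lia.
  have iz : (i%:Z < n%:Z)%R by rewrite ltz_nat.
  rewrite nE in iz.
  have h1 : (m < m + 1 + i%:Z)%R by lia.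
  have h2 : (m + 1 + i%:Z <= Num.floor beta)%R by lia.
  by rewrite floor_lt_int in h1; rewrite floor_ge_int in h2; rewrite /= h1 h2.
rewrite (_ : \esum_(k in _) _ = \esum_(k in e @` `I_n) 1%E); last first.
  rewrite -SE [RHS]esum_mkcond; apply: eq_esum => k _.
  rewrite indicE; have -> : ((k%:~R : R) \in `]alpha, beta]%classic) =
     (k \in [set k : int | (alpha < k%:~R <= beta)%R]).
    by apply/idP/idP; rewrite !inE.
  by case: ifP.
rewrite esum_image// esum_fset//.
rewrite -fsbig_ord sumEFin sumr_const card_ord lee_fin -[n%:R]/((n%:Z)%:~R) nE.
rewrite intrD intrN; have := floor_le beta; have := floorD1_gt alpha.
rewrite intrD -/m; lra.
Qed.

(** If [x] and [x + s] are separated by the endpoints of an interval, then [x]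
    lies within [`|s|] of an endpoint; hence the bound linear in [s], uniform
    in the length of the interval. *)
Lemma esum_int_itv_shift_le (alpha beta s : R) : (alpha <= beta)%R ->
  \esum_(k in [set: int])
    `| \1_`]alpha, beta]%classic (k%:~R : R) -
      \1_`]alpha, beta]%classic (k%:~R + s : R)|%:E <=
  (Num.min (4 * `|s| + 2) (2 * (beta - alpha + 1)))%:E.
Proof.
move=> ab; have s0 : (0 <= `|s|)%R by [].
have [s1 s2] : (s <= `|s|)%R /\ (- s <= `|s|)%R.
  by rewrite ler_norm -normrN ler_norm.
rewrite EFin_min le_min; apply/andP; split.
  pose I (x : R) := `](x - `|s|)%R, (x + `|s|)%R]%classic.
  apply: (@le_trans _ _ (\esum_(k in [set: int]) ((\1_(I alpha) (k%:~R : R))%:E +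
      (\1_(I beta) (k%:~R : R))%:E))).
    apply: le_esum => k _; rewrite -EFinD lee_fin !indicE /I !mem_setE !in_itv/=.
    move: (k%:~R : R) => x.
    (* An indicator of an interval is a difference of two indicators of half
       lines, each of which jumps at one endpoint only. *)
    have tails (y : R) : ((alpha < y <= beta)%R%:R =
        (alpha < y)%R%:R - (beta < y)%R%:R :> R)%R.
      by case: (ltP alpha y) => h1; case: (leP y beta) => h2; rewrite /=; lra.
    have jump (t : R) : (`|(t < x)%R%:R - (t < x + s)%R%:R| <=
        (t - `|s| < x <= t + `|s|)%R%:R :> R)%R.
      case: (ltP t x) => h1; case: (ltP t (x + s)%R) => h2;
        rewrite /= ?subrr ?subr0 ?sub0r ?normrN ?normr0 ?normr1//;
        by case: (ltP (t - `|s|)%R x) => h3;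
          case: (leP x (t + `|s|)%R) => h4; rewrite /=; lra.
    have triangle (a b c d : R) : (`|a - b - (c - d)| <= `|a - c| + `|b - d|)%R.
      have -> : (a - b - (c - d) = (a - c) - (b - d))%R by ring.
      exact: ler_normB.
    by rewrite !tails; apply: le_trans (triangle _ _ _ _) (lerD (jump alpha) (jump beta)).
  rewrite esumD//.
  apply: (@le_trans _ _ ((alpha + `|s| - (alpha - `|s|) + 1)%:E +
      (beta + `|s| - (beta - `|s|) + 1)%:E)).
    by apply: leeD; apply: esum_int_itv_le; lra.
  by rewrite -EFinD lee_fin; lra.
apply: (@le_trans _ _ (\esum_(k in [set: int]) ((\1_`]alpha, beta]%classic (k%:~R : R))%:E +
      (\1_`](alpha - s)%R, (beta - s)%R]%classic (k%:~R : R))%:E))).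
  apply: le_esum => k _; rewrite -EFinD lee_fin.
  have -> : (\1_`]alpha, beta]%classic (k%:~R + s : R) =
      \1_`]alpha - s, beta - s]%classic (k%:~R : R) :> R)%R.
    by rewrite !indicE !mem_setE !in_itv/= ltrBlDr lerBrDr.
  by rewrite (le_trans (ler_normB _ _))// !ger0_norm.
rewrite esumD//.
apply: (@le_trans _ _ ((beta - alpha + 1)%:E + ((beta - s) - (alpha - s) + 1)%:E)).
  by apply: leeD; apply: esum_int_itv_le; lra.
by rewrite -EFinD lee_fin; lra.
Qed.

End Counting.

(** * Absolutely summable translates *)

Section TranslatesBound.
Context {R : realType}.
Implicit Types (g : R -> R) (M nu : R).
Local Open Scope ereal_scope.

Definition translates_bounded g M : Prop :=
  forall u : R, \esum_(k in [set: int]) `|g (u - k%:~R)%R|%:E <= M%:E.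

Let moment_bound nu g : abs_moment nu g < +oo ->
  exists2 M : R, (0 <= M)%R & forall u : R,
    \esum_(k in [set: int]) (`|g (u - k%:~R)| * `|u - k%:~R| `^ nu)%:E <= M%:E.
Proof.
move=> gnu; have sup_ub u : \esum_(k in [set: int])
    (`|g (u - k%:~R)| * `|u - k%:~R| `^ nu)%:E <= abs_moment nu g.
  by apply: ereal_sup_ubound; exists u.
have moment_ge0 : 0 <= abs_moment nu g.
  apply: le_trans (sup_ub 0%R); apply: esum_ge0 => k _.
  by rewrite lee_fin mulr_ge0// powR_ge0.
exists (fine (abs_moment nu g)); first exact: fine_ge0.
by move=> u; rewrite fineK// ge0_fin_numE.
Qed.

Lemma translates_bounded_moment0 g : abs_moment 0 g < +oo ->
  exists2 M : R, (0 < M)%R & translates_bounded g M.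
Proof.
move=> /moment_bound[M M0 gM]; exists (M + 1)%R; first by rewrite ltr_wpDl.
move=> u; apply: le_trans (_ : M%:E <= _); last by rewrite lee_fin lerDl.
apply: le_trans (gM u); apply: le_esum => k _.
by rewrite powRr0 mulr1.
Qed.

(** Away from the origin the moment controls the sum of the translates; near
    the origin at most two integers contribute, and there [g] is bounded. *)
Lemma translates_bounded_moment g nu : bounded_near g (nbhs (0%R : R)) ->
  (0 < nu)%R -> abs_moment nu g < +oo ->
  exists2 M : R, (0 < M)%R & translates_bounded g M.
Proof.
move=> /ex_bound[C gC] nu0 /moment_bound[M M0 gM].
have [d /= d0 dC] : exists2 d : R, (0 < d)%R & forall x, (`|x| < d -> `|g x| <= C)%R.
  move/nbhs_ballP : gC => [d /= d0 dC]; exists d => // x xd; apply: dC.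
  by rewrite /ball/= sub0r normrN.
(* At most [1 / 2], so that few translates see the neighborhood. *)
pose e := Num.min d (2^-1)%R.
have e0 : (0 < e)%R by rewrite lt_min d0/= invr_gt0.
have [ed e2] : (e <= d)%R /\ (e <= 2^-1)%R by rewrite !ge_min !lexx orbT.
have C0 : (0 <= C)%R.
  by apply: le_trans (dC 0%R _) => //; rewrite normr0.
pose c := (e `^ nu)%R.
have c0 : (0 < c)%R by rewrite powR_gt0.
exists (c^-1 * M + C * 2 + 1)%R.
  by rewrite ltr_wpDl// addr_ge0// mulr_ge0// invr_ge0 ltW.
move=> u; apply: le_trans (_ : (c^-1 * M + C * 2)%:E <= _); last by rewrite lee_fin lerDl.
rewrite EFinD.
apply: (@le_trans _ _ (\esum_(k in [set: int])
   ((c^-1 * (`|g (u - k%:~R)| * `|u - k%:~R| `^ nu))%:E +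
    (C * \1_`](u - 2^-1)%R, (u + 2^-1)%R]%classic (k%:~R : R))%:E))).
  apply: le_esum => k _; rewrite -EFinD lee_fin.
  (* Either [`|u - k| / e >= 1], and the first term dominates, or the second. *)
  have [ku|ku] := leP e `|(u - k%:~R)|%R.
    apply: ler_wpDr; first by rewrite mulr_ge0.
    rewrite mulrCA ler_peMr// ler_pdivlMl// mulr1.
    by rewrite /c ge0_ler_powR ?nnegrE// ltW.
  apply: ler_wpDl; first by rewrite !mulr_ge0// ?invr_ge0 ?powR_ge0// ltW.
  have := ku; rewrite ltr_norml => /andP[k1 k2].
  rewrite indicE mem_set ?mulr1; first by apply: dC; exact: lt_le_trans ku _.
  by rewrite /= in_itv/=; apply/andP; split; lra.
rewrite esumD//; last 2 first.
- by move=> k _; rewrite lee_fin !mulr_ge0// ?invr_ge0 ?powR_ge0// ltW.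
- by move=> k _; rewrite lee_fin mulr_ge0.
have esumZ (a : R) (F : int -> R) : (0 <= a)%R -> (forall k, 0 <= F k)%R ->
    \esum_(k in [set: int]) (a * F k)%:E = a%:E * \esum_(k in [set: int]) (F k)%:E.
  move=> a0 F0; rewrite !esum_int_of_index//; last first.
    by move=> k; rewrite lee_fin mulr_ge0.
  rewrite -nneseriesZl; last by move=> i _; rewrite lee_fin.
  by apply: eq_eseriesr => i _; rewrite EFinM.
rewrite !esumZ ?invr_ge0 ?(ltW c0)//.
rewrite !EFinM; apply: leeD; apply: lee_wpmul2l; rewrite ?lee_fin ?invr_ge0 ?(ltW c0)//.
apply: le_trans (esum_int_itv_le _) _; first by lra.
by rewrite lee_fin; lra.
Qed.

Lemma translates_bounded_norm g M (x : R) : translates_bounded g M ->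
  (`|g x| <= M)%R.
Proof.
move=> /(_ x) gM; rewrite -lee_fin; apply: le_trans gM.
apply: esum_ge; exists [set 0%R]; first by split => //; exact: finite_set1.
by rewrite fsbig_set1 subr0.
Qed.

End TranslatesBound.

(** * Kernels given by two families of weights *)

Section AdmissibleFamilies.
Local Open Scope ereal_scope.
Context d (T : measurableType d) {R : realType}.
Variable mu : {measure set T -> \bar R}.
Implicit Types (a b : nat -> T -> R) (P Q : T -> R) (M m : R) (n : nat).

Definition nonneg_mfun P : Prop :=
  measurable_fun setT P /\ forall x, (0 <= P x)%R.

(** [M] bounds the series at each point, [m] the integral of each term: these
    are the two ways in which a weight |g(w x - k)| can be summed. *)
Definition admissible a M m : Prop :=
  [/\ forall n, nonneg_mfun (a n),
      (0 <= M)%R /\ (forall x, \sum_(n <oo) (a n x)%:E <= M%:E) &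
      (0 <= m)%R /\ (forall n, \int[mu]_x (a n x)%:E <= m%:E)].

Definition mass P Q : \bar R := \int[mu]_x (P x * Q x)%:E.

Lemma nonneg_mfun1 : nonneg_mfun (cst 1%R).
Proof. by split. Qed.

Lemma nonneg_mfunD P Q : nonneg_mfun P -> nonneg_mfun Q ->
  nonneg_mfun (fun x => P x + Q x)%R.
Proof.
move=> [mP P0] [mQ Q0]; split; first exact: measurable_funD.
by move=> x; rewrite addr_ge0.
Qed.

Lemma nonneg_mfunM P Q : nonneg_mfun P -> nonneg_mfun Q ->
  nonneg_mfun (fun x => P x * Q x)%R.
Proof.
move=> [mP P0] [mQ Q0]; split; first exact: measurable_funM.
by move=> x; rewrite mulr_ge0.
Qed.

Lemma nonneg_mfunZ P (c : R) : nonneg_mfun P -> (0 <= c)%R ->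
  nonneg_mfun (fun x => c * P x)%R.
Proof.
move=> [mP P0] c0; split; first exact: measurable_funM.
by move=> x; rewrite mulr_ge0.
Qed.

Lemma nonneg_mfun_indic (E : set T) : measurable E -> nonneg_mfun (\1_E : T -> R).
Proof. by move=> mE; split; [exact: measurable_indic|]. Qed.

Lemma nonneg_mfun_EFin P : nonneg_mfun P ->
  measurable_fun setT (fun x => (P x)%:E).
Proof. by move=> [mP _]; exact/measurable_EFinP. Qed.

Lemma le_nonneg_integral P Q : nonneg_mfun P -> nonneg_mfun Q ->
  (forall x, P x <= Q x)%R -> \int[mu]_x (P x)%:E <= \int[mu]_x (Q x)%:E.
Proof.
move=> hP hQ PQ; apply: ge0_le_integral => //.
- by move=> x _; rewrite lee_fin; case: hP.
- exact: nonneg_mfun_EFin.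
- exact: nonneg_mfun_EFin.
- by move=> x _; rewrite lee_fin.
Qed.

Lemma nonneg_integral_ge0 P : nonneg_mfun P -> 0 <= \int[mu]_x (P x)%:E.
Proof. by move=> [_ P0]; apply: integral_ge0 => x _; rewrite lee_fin. Qed.

Lemma nonneg_integralD P Q : nonneg_mfun P -> nonneg_mfun Q ->
  \int[mu]_x (P x + Q x)%:E = \int[mu]_x (P x)%:E + \int[mu]_x (Q x)%:E.
Proof.
move=> hP hQ; rewrite -ge0_integralD//.
- by move=> x _; rewrite lee_fin; case: hP.
- exact: nonneg_mfun_EFin.
- by move=> x _; rewrite lee_fin; case: hQ.
- exact: nonneg_mfun_EFin.
Qed.

Lemma nonneg_integralZ P (c : R) : nonneg_mfun P -> (0 <= c)%R ->
  \int[mu]_x (c * P x)%:E = c%:E * \int[mu]_x (P x)%:E.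
Proof.
move=> hP c0; rewrite -ge0_integralZl//.
- exact: nonneg_mfun_EFin.
- by move=> x _; rewrite lee_fin; case: hP.
Qed.

Lemma nonneg_integral_series (P : nat -> T -> R) : (forall n, nonneg_mfun (P n)) ->
  \int[mu]_x (\sum_(n <oo) (P n x)%:E) = \sum_(n <oo) \int[mu]_x (P n x)%:E.
Proof.
move=> hP; rewrite integral_nneseries//.
- by move=> n; exact: (nonneg_mfun_EFin (hP n)).
- by move=> n x _; rewrite lee_fin; case: (hP n).
Qed.

Lemma mass_ge0 P Q : nonneg_mfun P -> nonneg_mfun Q -> 0 <= mass P Q.
Proof.
by move=> [_ P0] [_ Q0]; apply: integral_ge0 => x _; rewrite lee_fin mulr_ge0.
Qed.

Lemma le_mass P Q Q' : nonneg_mfun P -> nonneg_mfun Q -> nonneg_mfun Q' ->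
  (forall x, Q x <= Q' x)%R -> mass P Q <= mass P Q'.
Proof.
move=> hP hQ hQ' QQ'; apply: le_nonneg_integral; [exact: nonneg_mfunM..|].
by move=> x; rewrite ler_wpM2l//; case: hP.
Qed.

Lemma massD P Q Q' : nonneg_mfun P -> nonneg_mfun Q -> nonneg_mfun Q' ->
  mass P (fun x => Q x + Q' x)%R = mass P Q + mass P Q'.
Proof.
move=> hP hQ hQ'.
rewrite /mass -(nonneg_integralD (nonneg_mfunM hP hQ) (nonneg_mfunM hP hQ')).
by apply: eq_integral => x _; rewrite mulrDr.
Qed.

Lemma massZ P Q (c : R) : nonneg_mfun P -> nonneg_mfun Q -> (0 <= c)%R ->
  mass P (fun x => c * Q x)%R = c%:E * mass P Q.
Proof.
move=> hP hQ c0; rewrite /mass -(nonneg_integralZ (nonneg_mfunM hP hQ) c0).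
by apply: eq_integral => x _; rewrite mulrCA.
Qed.

Lemma mass1 a M m n : admissible a M m -> mass (a n) (cst 1%R) <= m%:E.
Proof.
move=> [_ _ [_ /(_ n) am]]; apply: le_trans am; rewrite le_eqVlt.
by apply/predU1P; left; apply: eq_integral => x _; rewrite /= mulr1.
Qed.

Lemma sum_mass a M m P : admissible a M m -> nonneg_mfun P ->
  \sum_(n <oo) mass (a n) P <= M%:E * \int[mu]_x (P x)%:E.
Proof.
move=> [ha [M0 aM] _] hP; have [mP P0] := hP.
have haP n := nonneg_mfunM (ha n) hP.
have haP0 n x : 0 <= (a n x * P x)%:E by rewrite lee_fin; case: (haP n).
have mhaP n : measurable_fun setT (fun x => (a n x * P x)%:E).
  exact: (nonneg_mfun_EFin (haP n)).
rewrite /mass -integral_nneseries//.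
rewrite -ge0_integralZl//; last 2 first.
- exact: nonneg_mfun_EFin.
- by move=> x _; rewrite lee_fin.
apply: ge0_le_integral => //.
- by move=> x _; apply: nneseries_ge0.
- by apply: ge0_emeasurable_sum.
- apply: measurable_funeM; exact: nonneg_mfun_EFin.
move=> x _; under eq_eseriesr do rewrite mulrC EFinM.
rewrite nneseriesZl; last by move=> n _; rewrite lee_fin; case: (ha n).
by rewrite muleC lee_wpmul2r// lee_fin.
Qed.

(** The double integral of [P x * Q u] against the kernel
    [\sum_n a n x * b n u], as [transferE] shows. *)
Definition transfer a b P Q : \bar R :=
  \sum_(n <oo) (mass (a n) P * mass (b n) Q).

Lemma transferC a b P Q : transfer a b P Q = transfer b a Q P.
Proof. by apply: eq_eseriesr => n _; rewrite muleC. Qed.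

(** Integrate the [b n] first, for which [m'] is available, and then sum the
    [a n], for which [M] is. *)
Lemma transfer1r a b M m M' m' P : admissible a M m -> admissible b M' m' ->
  nonneg_mfun P -> transfer a b P (cst 1%R) <= (M * m')%:E * \int[mu]_x (P x)%:E.
Proof.
move=> adA adB hP; have [ha _ _] := adA; have [hb _ [m0 _]] := adB.
apply: (@le_trans _ _ (\sum_(n <oo) (m'%:E * mass (a n) P))).
  apply: lee_nneseries => n.
    by rewrite mule_ge0 ?mass_ge0//; exact: nonneg_mfun1.
  move=> _; rewrite muleC lee_wpmul2r ?mass_ge0//.
  exact: mass1 adB.
rewrite nneseriesZl; last by move=> n _; rewrite mass_ge0.
by rewrite mulrC EFinM -muleA lee_wpmul2l ?lee_fin//; exact: sum_mass adA _.
Qed.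

Lemma transfer1l a b M m M' m' Q : admissible a M m -> admissible b M' m' ->
  nonneg_mfun Q -> transfer a b (cst 1%R) Q <= (m * M')%:E * \int[mu]_x (Q x)%:E.
Proof.
by move=> adA adB hQ; rewrite transferC mulrC; exact: (transfer1r adB adA).
Qed.

Section Families.
Variables (a b : nat -> T -> R).
Hypotheses (ha : forall n, nonneg_mfun (a n)) (hb : forall n, nonneg_mfun (b n)).

Lemma le_transfer P P' Q Q' :
  nonneg_mfun P -> nonneg_mfun P' -> nonneg_mfun Q -> nonneg_mfun Q' ->
  (forall x, P x <= P' x)%R -> (forall x, Q x <= Q' x)%R ->
  transfer a b P Q <= transfer a b P' Q'.
Proof.
move=> hP hP' hQ hQ' PP' QQ'; apply: lee_nneseries => n.
  by rewrite mule_ge0 ?mass_ge0.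
by move=> _; apply: lee_pmul; rewrite ?mass_ge0 ?le_mass.
Qed.

Lemma transfer_ge0 P Q : nonneg_mfun P -> nonneg_mfun Q -> 0 <= transfer a b P Q.
Proof.
by move=> hP hQ; apply: nneseries_ge0 => n _ _; rewrite mule_ge0 ?mass_ge0.
Qed.

Lemma transferDl P P' Q : nonneg_mfun P -> nonneg_mfun P' -> nonneg_mfun Q ->
  transfer a b (fun x => P x + P' x)%R Q = transfer a b P Q + transfer a b P' Q.
Proof.
move=> hP hP' hQ; rewrite /transfer -nneseriesD; last 2 first.
- by move=> n _ _; rewrite mule_ge0 ?mass_ge0.
- by move=> n _ _; rewrite mule_ge0 ?mass_ge0.
by apply: eq_eseriesr => n _; rewrite massD// ge0_muleDl ?mass_ge0.
Qed.

Lemma transferZl P Q (c : R) : nonneg_mfun P -> nonneg_mfun Q -> (0 <= c)%R ->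
  transfer a b (fun x => c * P x)%R Q = c%:E * transfer a b P Q.
Proof.
move=> hP hQ c0; rewrite /transfer -nneseriesZl; last first.
  by move=> n _; rewrite mule_ge0 ?mass_ge0.
by apply: eq_eseriesr => n _; rewrite massZ// muleA.
Qed.

Definition kernel_of (x u : T) : \bar R := \sum_(n <oo) (a n x * b n u)%:E.

Lemma kernel_of_ge0 x u : 0 <= kernel_of x u.
Proof.
apply: nneseries_ge0 => n _ _; rewrite lee_fin mulr_ge0//.
  by case: (ha n).
by case: (hb n).
Qed.

Lemma measurable_kernel_of x : measurable_fun setT (kernel_of x).
Proof.
apply: ge0_emeasurable_sum => n.
  move=> u _ _; rewrite lee_fin mulr_ge0//; first by case: (ha n).
  by case: (hb n).
have an0 : (0 <= a n x)%R by case: (ha n).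
by move=> _; exact: (nonneg_mfun_EFin (nonneg_mfunZ (hb n) an0)).
Qed.

Lemma integral_kernel_of x Q : nonneg_mfun Q ->
  \int[mu]_u (kernel_of x u * (Q u)%:E) =
  \sum_(n <oo) ((a n x)%:E * mass (b n) Q).
Proof.
move=> hQ; have [mQ Q0] := hQ; have hbQ n := nonneg_mfunM (hb n) hQ.
have a0 n : (0 <= a n x)%R by case: (ha n).
have hab n := nonneg_mfunZ (hbQ n) (a0 n).
rewrite (eq_integral (fun u => \sum_(n <oo) (a n x * (b n u * Q u))%:E)); last first.
  move=> u _; rewrite /kernel_of muleC -nneseriesZl.
    by apply: eq_eseriesr => n _; rewrite muleC -EFinM mulrA.
  move=> n _; rewrite lee_fin mulr_ge0//.
  by case: (hb n).
rewrite integral_nneseries//; last 2 first.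
- by move=> n; exact: (nonneg_mfun_EFin (hab n)).
- by move=> n u _; rewrite lee_fin; case: (hab n).
apply: eq_eseriesr => n _; rewrite /mass -ge0_integralZl//.
- exact: (nonneg_mfun_EFin (hbQ n)).
- by move=> u _; rewrite lee_fin; case: (hbQ n).
- by rewrite lee_fin.
Qed.

Let fine_mul_series (c : R) (F : nat -> \bar R) : (forall n, 0 <= F n) ->
  c%:E * \sum_(n <oo) F n = \sum_(n <oo) (c%:E * F n).
Proof. by move=> F0; rewrite nneseriesZl. Qed.

Lemma measurable_integral_kernel_of P Q : nonneg_mfun P -> nonneg_mfun Q ->
  measurable_fun setT
    (fun x => (P x)%:E * \int[mu]_u (kernel_of x u * (Q u)%:E)).
Proof.
move=> hP hQ.
apply: emeasurable_funM; first exact: nonneg_mfun_EFin.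
rewrite (_ : (fun x => _) = fun x => \sum_(n <oo) ((a n x)%:E * mass (b n) Q)).
  apply: ge0_emeasurable_sum => n.
    by move=> x _ _; rewrite mule_ge0 ?mass_ge0// lee_fin; case: (ha n).
  move=> _; apply: emeasurable_funM; first exact: (nonneg_mfun_EFin (ha n)).
  exact: measurable_cst.
by apply/funext => x; rewrite integral_kernel_of.
Qed.

Lemma transferE P Q : nonneg_mfun P -> nonneg_mfun Q ->
  \int[mu]_x ((P x)%:E * \int[mu]_u (kernel_of x u * (Q u)%:E)) = transfer a b P Q.
Proof.
move=> hP hQ; have haP n := nonneg_mfunM (ha n) hP.
have haP0 n x : 0 <= mass (b n) Q * (a n x * P x)%:E.
  by rewrite mule_ge0 ?mass_ge0// lee_fin; case: (haP n).
rewrite (eq_integral (fun x => \sum_(n <oo) (mass (b n) Q * (a n x * P x)%:E))).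
  rewrite integral_nneseries//; last first.
    by move=> n; apply: measurable_funeM; exact: (nonneg_mfun_EFin (haP n)).
  apply: eq_eseriesr => n _; rewrite muleC /mass -ge0_integralZl//.
  - exact: (nonneg_mfun_EFin (haP n)).
  - by move=> u _; rewrite lee_fin; case: (haP n).
  - exact: mass_ge0.
move=> x _; rewrite integral_kernel_of// fine_mul_series; last first.
  by move=> n; rewrite mule_ge0 ?mass_ge0// lee_fin; case: (ha n).
by apply: eq_eseriesr => n _; rewrite muleA muleC -EFinM [(P x * _)%R]mulrC.
Qed.

End Families.

End AdmissibleFamilies.

(** * The modular of a function dominated by a kernel *)

Section ModularEstimate.
Local Open Scope ereal_scope.
Context d (T : measurableType d) {R : realType}.
Variable mu : {measure set T -> \bar R}.
Variable eta : R -> R.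
Hypothesis heta : convex_phi_function eta.

Import HBNNSimple.

(** Compares suprema over the simple functions below [F] and below [G]. It is
    applied to an [F] built from the image of [f] under the operator, about
    which only pointwise bounds are known. *)
Lemma ge0_le_integral_nonmeasurable (F G : T -> \bar R) :
  (forall x, 0 <= F x) -> (forall x, F x <= G x) ->
  \int[mu]_x F x <= \int[mu]_x G x.
Proof.
move=> F0 FG; rewrite !ge0_integralTE//; last first.
  by move=> x; exact: le_trans (FG x).
apply: ge_ereal_sup => _ [h /= hF <-]; apply: ereal_sup_ubound.
by exists h => //= x; exact: le_trans (FG x).
Qed.

Lemma nonneg_mfun_eta (c : R) (v : T -> R) : (0 <= c)%R ->
  measurable_fun setT v -> nonneg_mfun (fun x => eta (c * `|v x|)%R).
Proof.
move=> c0 mv; split; last by move=> x; rewrite (phi_function_ge0 heta)// mulr_ge0.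
apply: (measurable_phi_function heta (g := fun x => (c * `|v x|)%R)).
  by apply: measurable_funM => //; exact: measurableT_comp.
by move=> x; rewrite mulr_ge0.
Qed.

(** Jensen's inequality at each [x] moves [eta] inside the kernel; there it is
    dominated by product functions, whose double integrals are transfers. *)
Lemma modular_le_transfer (a b : nat -> T -> R) (M m M' m' lam : R)
    (f t : T -> R) (I : Type) (l : seq I) (P Q : I -> T -> R) :
  admissible mu a M m -> admissible mu b M' m' -> (0 < M * m')%R ->
  (0 < lam)%R -> measurable_fun setT f -> (forall x, 0 <= t x)%R ->
  (forall x, (t x)%:E <=
     \int[mu]_u (kernel_of a b x u * (`|f u - f x|)%:E)) ->
  (forall i, nonneg_mfun (P i)) -> (forall i, nonneg_mfun (Q i)) ->
  (forall x u, (eta (lam * (M * m') * `|f u - f x|) <=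
     \sum_(i <- l) P i x * Q i u)%R) ->
  \int[mu]_x (eta (lam * t x))%:E <=
  ((M * m')^-1)%:E * \sum_(i <- l) transfer mu a b (P i) (Q i).
Proof.
move=> adA adB A0 lam0 mf t0 tK hP hQ fl; set A := (M * m')%R in A0 fl *.
have [ha _ _] := adA; have [hb _ [m0 _]] := adB.
pose J i x := (P i x)%:E * \int[mu]_u (kernel_of a b x u * (Q i u)%:E).
have J0 i x : 0 <= J i x.
  have [_ P0] := hP i; have [_ Q0] := hQ i; rewrite mule_ge0 ?lee_fin//.
  by apply: integral_ge0 => u _; rewrite mule_ge0 ?lee_fin// kernel_of_ge0.
have mJ i : measurable_fun setT (J i) by exact: measurable_integral_kernel_of.
have massK x : \int[mu]_u kernel_of a b x u <= A%:E.
  have := integral_kernel_of mu ha hb x (@nonneg_mfun1 _ T R).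
  under eq_integral do rewrite /= mule1.
  move=> ->; apply: (@le_trans _ _ (\sum_(n <oo) (m'%:E * (a n x)%:E))).
    apply: lee_nneseries => n; first move=> _ _.
      apply: mule_ge0; first by rewrite lee_fin; case: (ha n).
      by apply: mass_ge0 => //; exact: nonneg_mfun1.
    move=> _; rewrite muleC lee_wpmul2r//; last exact: mass1 adB.
    by rewrite lee_fin; case: (ha n).
  rewrite nneseriesZl; last by move=> n _; rewrite lee_fin; case: (ha n).
  rewrite /A mulrC EFinM lee_wpmul2l ?lee_fin//.
  by case: adA => _ [_ +] _; exact.
have mKQ i x : measurable_fun setT (fun u => (P i x)%:E *
    (kernel_of a b x u * (Q i u)%:E)).
  apply: measurable_funeM; apply: emeasurable_funM.
    exact: measurable_kernel_of.
  exact: nonneg_mfun_EFin.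
have KQ0 i x u : 0 <= (P i x)%:E * (kernel_of a b x u * (Q i u)%:E).
  have [_ P0] := hP i; have [_ Q0] := hQ i.
  by rewrite !mule_ge0 ?lee_fin// kernel_of_ge0.
have pointwise x : (A * eta (lam * t x))%:E <= \sum_(i <- l) J i x.
  apply: (@le_trans _ _ (\int[mu]_u (kernel_of a b x u *
      (eta (A * (lam * `|f u - f x|)))%:E))).
    have mfx : measurable_fun setT (fun u => `|f u - f x|)%R.
      by apply: measurableT_comp => //; exact: measurable_funB.
    apply: (phi_function_jensen heta (g := fun u => lam * `|f u - f x|)%R) => //.
    - exact: measurable_kernel_of.
    - by move=> u; exact: kernel_of_ge0.
    - exact: measurable_funM.
    - by move=> u; rewrite mulr_ge0// ltW.
    - by rewrite mulr_ge0// ltW.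
    rewrite EFinM (eq_integral (fun u =>
      lam%:E * (kernel_of a b x u * (`|f u - f x|)%:E))); last first.
      by move=> u _; rewrite EFinM muleCA.
    rewrite ge0_integralZl//; last 3 first.
    - apply: emeasurable_funM; first exact: measurable_kernel_of.
      exact/measurable_EFinP.
    - by move=> u _; rewrite mule_ge0// kernel_of_ge0.
    - by rewrite lee_fin ltW.
    by rewrite lee_wpmul2l// lee_fin ltW.
  have -> : \sum_(i <- l) J i x = \int[mu]_u \sum_(i <- l)
     ((P i x)%:E * (kernel_of a b x u * (Q i u)%:E)).
    rewrite ge0_integral_sum//; apply: eq_bigr => i _.
    rewrite /J ge0_integralZl//.
    - apply: emeasurable_funM; first exact: measurable_kernel_of.
      exact: nonneg_mfun_EFin.
    - move=> u _; rewrite mule_ge0// ?kernel_of_ge0// lee_fin.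
      by case: (hQ i).
    - by rewrite lee_fin; case: (hP i).
  apply: ge0_le_integral_nonmeasurable => u.
    rewrite mule_ge0 ?kernel_of_ge0// lee_fin (phi_function_ge0 heta)//.
    by rewrite mulr_ge0 ?(ltW A0)// mulr_ge0// ltW.
  have := fl x u; rewrite -lee_fin => h.
  apply: (@le_trans _ _ (kernel_of a b x u * (\sum_(i <- l) P i x * Q i u)%:E)).
    by rewrite lee_wpmul2l ?kernel_of_ge0// mulrA [(A * lam)%R]mulrC.
  rewrite -sumEFin ge0_sume_distrr; last first.
    move=> i _; rewrite lee_fin mulr_ge0//; first by case: (hP i).
    by case: (hQ i).
  by apply: lee_sum => i _; rewrite EFinM muleCA.
apply: (@le_trans _ _ (\int[mu]_x ((A^-1)%:E * \sum_(i <- l) J i x))).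
  apply: ge0_le_integral_nonmeasurable => x.
    by rewrite lee_fin (phi_function_ge0 heta)// mulr_ge0// ltW.
  by rewrite lee_pdivlMl//; exact: pointwise.
rewrite ge0_integralZl//; last 3 first.
- exact: emeasurable_sum.
- by move=> x _; exact: sume_ge0.
- by rewrite lee_fin invr_ge0 ltW.
rewrite ge0_integral_sum// lee_wpmul2l ?lee_fin ?invr_ge0 ?(ltW A0)//.
by apply: lee_sum => i _; rewrite /J transferE.
Qed.

End ModularEstimate.

(** * Approximation by simple functions in modular *)

Section SimpleApproximation.
Local Open Scope ereal_scope.
Context d (T : measurableType d) {R : realType}.
Variable mu : {measure set T -> \bar R}.
Variable eta : R -> R.
Hypothesis heta : convex_phi_function eta.
Import HBNNSimple.

Let nonneg_simple_approx (v : T -> R) : nonneg_mfun v ->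
  exists p : nat -> T -> R,
    [/\ forall n, measurable_fun setT (p n),
        forall n x, (0 <= p n x <= v x)%R,
        forall x, p ^~ x @ \oo --> v x &
        forall n, exists r : seq R, forall x, p n x \in r].
Proof.
move=> [mv v0].
have mv' : measurable_fun setT (EFin \o v) by exact/measurable_EFinP.
have v0' x : setT x -> 0 <= (EFin \o v) x by move=> _; rewrite lee_fin.
exists (fun n => nnsfun_approx measurableT mv' n); split.
- by move=> n.
- move=> n x; rewrite fun_ge0 andTb nnsfun_approxE -lee_fin.
  exact: (le_approx n v0' (I : setT x)).
- move=> x; have := cvg_nnsfun_approx measurableT mv' v0' (I : setT x).
  by move=> /fine_cvg; apply: cvg_trans.
- move=> n.
  have /finite_seqP[r rE] := @fimfunP _ _ (nnsfun_approx measurableT mv' n).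
  exists r => x; suff : [set` r] (nnsfun_approx measurableT mv' n x) by [].
  by rewrite -rE; exists x.
Qed.

(** Approximate the positive and the negative part from below by simple
    functions: the difference [s] and the error [f - s] are both at most
    [`|f|] in absolute value, so that the modular of [f] dominates the error,
    which allows dominated convergence, and the modular of [s], which bounds
    the measure of the level sets off 0. *)
Lemma modular_simple_approx (f : T -> R) (c e : R) : (0 < c)%R -> (0 < e)%R ->
  measurable_fun setT f -> \int[mu]_x (eta (c * `|f x|))%:E < +oo ->
  exists s : T -> R,
    [/\ measurable_fun setT s,
        exists r : seq R, forall x, s x \in r,
        forall y, y != 0%R -> mu (s @^-1` [set y]) < +oo &
        \int[mu]_x (eta (c * `|f x - s x|))%:E <= e%:E].
Proof.
move=> c0 e0 mf foo.
have [p [mp p_itv p_cvg p_fin]] : exists p : nat -> T -> R,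
    [/\ forall n, measurable_fun setT (p n),
        forall n x, (0 <= p n x <= f^\+%R x)%R,
        forall x, p ^~ x @ \oo --> f^\+%R x &
        forall n, exists r : seq R, forall x, p n x \in r].
  apply: nonneg_simple_approx; split; first exact: measurable_funrpos.
  exact: funrpos_ge0.
have [q [mq q_itv q_cvg q_fin]] : exists p : nat -> T -> R,
    [/\ forall n, measurable_fun setT (p n),
        forall n x, (0 <= p n x <= f^\-%R x)%R,
        forall x, p ^~ x @ \oo --> f^\-%R x &
        forall n, exists r : seq R, forall x, p n x \in r].
  apply: nonneg_simple_approx; split; first exact: measurable_funrneg.
  exact: funrneg_ge0.
pose s n x := (p n x - q n x)%R.
have ms n : measurable_fun setT (s n) by exact: measurable_funB.
have fE x : (f x = f^\+%R x - f^\-%R x)%R by rewrite -[in LHS](funrposBneg f).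
have fN x : (`|f x| = f^\+%R x + f^\-%R x)%R.
  by have /(congr1 (fun g => g x)) := funrposDneg f.
have s_le n x : (`|s n x| <= `|f x|)%R.
  have /andP[p0 pf] := p_itv n x; have /andP[q0 qf] := q_itv n x.
  by rewrite fN /s ler_norml; apply/andP; split; lra.
have fs_le n x : (`|f x - s n x| <= `|f x|)%R.
  have /andP[p0 pf] := p_itv n x; have /andP[q0 qf] := q_itv n x.
  by rewrite fN [in leLHS]fE /s ler_norml; apply/andP; split; lra.
have mF (v : T -> R) : measurable_fun setT v ->
    measurable_fun setT (fun x => (eta (c * `|v x|))%:E).
  move=> mv; apply: nonneg_mfun_EFin; apply: nonneg_mfun_eta => //.
  exact: ltW.
have F0 (v : R) : 0 <= (eta (c * `|v|))%:E.
  by rewrite lee_fin (phi_function_ge0 heta)// mulr_ge0// ltW.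
have F_le (v v' : R) : (`|v| <= `|v'|)%R -> (eta (c * `|v|))%:E <= (eta (c * `|v'|))%:E.
  move=> vv'; rewrite lee_fin (phi_function_le heta)//.
    by rewrite mulr_ge0// ltW.
  by rewrite ler_pM2l.
have lim0 : (fun n => \int[mu]_x (eta (c * `|f x - s n x|))%:E) @ \oo --> 0.
  have [] := @dominated_convergence _ _ _ mu setT measurableT
    (fun n x => (eta (c * `|f x - s n x|))%:E) (cst 0)
    (fun x => (eta (c * `|f x|))%:E).
  - by move=> n; apply: mF; exact: measurable_funB.
  - exact: measurable_cst.
  - apply: aeW => x _; apply: cvg_EFin; first exact: nearW.
    apply: (phi_function_cvg0 heta (v := fun n => c * `|f x - s n x|)%R).
      by move=> n; rewrite mulr_ge0// ltW.
    rewrite -[X in _ --> X](mulr0 c); apply: cvgMl_tmp => //.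
    rewrite -[X in _ --> X](normr0 R); apply: cvg_norm.
    rewrite -[X in _ --> X](subrr (f x)); apply: cvgB; first exact: cvg_cst.
    by rewrite fE; apply: cvgB.
  - apply/integrableP; split; first exact: mF.
    by under eq_integral do rewrite gee0_abs//.
  - by apply: aeW => x n _; rewrite gee0_abs// F_le.
  by move=> _ _; rewrite integral0.
have [N _ sN] : \forall n \near \oo,
    \int[mu]_x (eta (c * `|f x - s n x|))%:E <= e%:E.
  move/fine_cvgP : lim0 => [fin /cvgr_le/(_ e e0) le_e].
  near=> n; rewrite -[leLHS]fineK ?lee_fin; near: n => //.
exists (s N); split => //.
- have [rp rpP] := p_fin N; have [rq rqP] := q_fin N.
  by exists [seq y - z | y <- rp, z <- rq]%R => x; exact: allpairs_f.
- move=> y y0.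
  have mE : measurable (s N @^-1` [set y]).
    by rewrite -[X in measurable X]setTI; apply: ms => //; exact: measurable_set1.
  have ey : (0 < eta (c * `|y|))%R.
    by case: heta => _ _; apply; rewrite mulr_gt0// normr_gt0.
  have : (eta (c * `|y|))%:E * mu (s N @^-1` [set y]) < +oo.
    apply: le_lt_trans foo.
    rewrite -[X in mu X]setIT -integral_indic// -ge0_integralZl//; last first.
      by apply/measurable_EFinP; exact: measurable_indic.
    apply: ge0_le_integral_nonmeasurable => x.
      by rewrite mule_ge0// lee_fin ?ltW.
    have [sy|sy] := eqVneq (s N x) y.
      by rewrite indicE mem_set ?mule1 -?sy ?F_le.
    by rewrite indicE memNset ?mule0//= => /eqP; rewrite (negbTE sy).
  move=> h; rewrite ltey; apply/eqP => muoo; move: h.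
  by rewrite muoo gt0_muley ?lte_fin// ltxx.
- exact: (sN N (leqnn N)).
Unshelve. all: by end_near. Qed.

End SimpleApproximation.

(** * Modular convergence for kernels that leak no mass *)

Section ModularConvergence.
Local Open Scope ereal_scope.
Context d (T : measurableType d) {R : realType}.
Variable mu : {measure set T -> \bar R}.

Lemma near_sum_le (W I : Type) (F : set_system W) {FF : Filter F} (l : seq I)
    (g : I -> W -> \bar R) :
  (forall i e, (0 < e)%R -> \forall w \near F, g i w <= e%:E) ->
  forall e, (0 < e)%R -> \forall w \near F, \sum_(i <- l) g i w <= e%:E.
Proof.
move=> gl; elim: l => [|i l IH] e e0.
  by apply: nearW => w; rewrite big_nil lee_fin ltW.
have e2 : (0 < e / 2)%R by rewrite divr_gt0.
apply: filterS2 (gl i _ e2) (IH _ e2) => w h1 h2.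
by rewrite big_cons (splitr e) EFinD leeD.
Qed.

Variable eta : R -> R.
Hypothesis heta : convex_phi_function eta.

(** Replace [f] by a simple function [s] close to it in modular. The errors are
    paid for by the marginals of the kernel, and [s] itself by the mass that
    crosses the boundaries of its level sets. *)
Lemma modular_approximation (W : Type) (F : set_system W) {FF : Filter F}
    (a b : W -> nat -> T -> R) (M m' : R) (m M' : W -> R) (B : R)
    (f : T -> R) (t : W -> T -> R) (c : R) :
  (\forall w \near F, [/\ admissible mu (a w) M (m w),
     admissible mu (b w) (M' w) m' & (m w * M' w <= B)%R]) ->
  (0 < M * m')%R -> (0 <= B)%R -> (0 < c)%R ->
  measurable_fun setT f -> \int[mu]_x (eta (c * `|f x|))%:E < +oo ->
  (forall w x, 0 <= t w x)%R ->
  (\forall w \near F, forall x, (t w x)%:E <=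
     \int[mu]_u (kernel_of (a w) (b w) x u * (`|f u - f x|)%:E)) ->
  (forall E, measurable E -> mu E < +oo -> forall e, (0 < e)%R ->
     \forall w \near F, transfer mu (a w) (b w) \1_E \1_(~` E) <= e%:E /\
       transfer mu (a w) (b w) \1_(~` E) \1_E <= e%:E) ->
  forall e, (0 < e)%R -> \forall w \near F,
    \int[mu]_x (eta (c / (3 * (M * m')) * t w x))%:E <= e%:E.
Proof.
set A := (M * m')%R => hab A0 B0 c0 mf foo t0 tK leak e e0.
have AB0 : (0 < A + B)%R by rewrite ltr_pwDl.
(* Chosen, with [rho] below, so that [A^-1 * (B * delta + A * delta + rho)],
   the bound reached at the end, is [e]. *)
pose delta := (e * A / (2 * (A + B)))%R.
have delta0 : (0 < delta)%R by apply: divr_gt0; apply: mulr_gt0.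
have [s [ms [r sr] s_fin s_delta]] := modular_simple_approx heta c0 delta0 mf foo.
pose lam := (c / (3 * A))%R.
have lam0 : (0 < lam)%R by rewrite divr_gt0// mulr_gt0.
have lamA : (3 * (lam * A) = c)%R by rewrite mulrCA /lam divfK// gt_eqF// mulr_gt0.
pose H x := eta (c * `|f x - s x|)%R.
have hH : nonneg_mfun H.
  by apply: nonneg_mfun_eta => //; [exact: ltW|exact: measurable_funB].
pose S := (\sum_(y <- r) `|y|)%R.
have S0 : (0 <= S)%R by apply: sumr_ge0.
have sS x : (`|s x| <= S)%R.
  by rewrite /S (big_rem _ (sr x))/= lerDl sumr_ge0.
(* Values of [s] differ by at most [2 * S]. *)
pose C := eta (c * (2 * S))%R.
have C0 : (0 <= C)%R by rewrite (phi_function_ge0 heta)// mulr_ge0 ?(ltW c0)// mulr_ge0.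
pose E y := s @^-1` [set y].
have mE y : measurable (E y).
  by rewrite -[X in measurable X]setTI; apply: ms => //; exact: measurable_set1.
(* Indices of the product functions [P i x * Q i u] whose sum dominates
   [eta (lam * A * `|f u - f x|)]: the two error terms, then for each nonzero
   value [y] of [s] the two ways of crossing the boundary of [E y]. *)
pose I := (bool + bool * R)%type.
pose r' := [seq y <- r | y != 0%R].
pose l : seq I := inl true :: inl false ::
  ([seq inr (true, y) | y <- r'] ++ [seq inr (false, y) | y <- r']).
pose P (i : I) : T -> R := match i with
  | inl true => cst 1%R
  | inl false => H
  | inr (true, y) => fun x => (C * \1_(E y) x)%R
  | inr (false, y) => fun x => (C * \1_(~` E y) x)%R
  end.
pose Q (i : I) : T -> R := match i with
  | inl true => H
  | inl false => cst 1%R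
  | inr (true, y) => \1_(~` E y)
  | inr (false, y) => \1_(E y)
  end.
have hE y : nonneg_mfun (\1_(E y) : T -> R) by exact: nonneg_mfun_indic.
have hEC y : nonneg_mfun (\1_(~` E y) : T -> R).
  by apply: nonneg_mfun_indic; exact: measurableC.
have hP i : nonneg_mfun (P i).
  by case: i => [[]|[[] y]]/=; [exact: nonneg_mfun1|exact: hH|exact: nonneg_mfunZ..].
have hQ i : nonneg_mfun (Q i).
  by case: i => [[]|[[] y]]/=; [exact: hH|exact: nonneg_mfun1|exact: hEC|exact: hE].
have pointwise x u : (eta (lam * A * `|f u - f x|) <=
     \sum_(i <- l) P i x * Q i u)%R.
  rewrite /l !big_cons/= mul1r mulr1 big_cat !big_map/=.
  have lA : (0 <= lam * A)%R by apply: mulr_ge0; exact: ltW.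
  have -> : (f u - f x = (f u - s u) + (s u - s x) - (f x - s x))%R by ring.
  apply: (@le_trans _ _ (eta (lam * A * `|f u - s u| + lam * A * `|s u - s x| +
      lam * A * `|f x - s x|))%R).
    apply: (phi_function_le heta); first by rewrite mulr_ge0.
    rewrite -!mulrDr ler_wpM2l// (le_trans (ler_normB _ _))// lerD2r.
    exact: ler_normD.
  have lA0 (v : R) : (0 <= lam * A * `|v|)%R by rewrite mulr_ge0.
  have := phi_function_add3 heta (lA0 (f u - s u)%R) (lA0 (s u - s x)%R) (lA0 (f x - s x)%R).
  move=> /le_trans; apply.
  have lamAv (v : R) : (3 * (lam * A * v) = c * v)%R by rewrite mulrA lamA.
  rewrite !lamAv -addrA lerD2l addrC lerD2l.
  have [->|sus] := eqVneq (s u) (s x).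
    rewrite subrr normr0 mulr0; case: (heta) => _ -> _.
    by rewrite addr_ge0// sumr_ge0// => y _; rewrite !mulr_ge0.
  apply: (@le_trans _ _ C).
    apply: (phi_function_le heta); first by rewrite mulr_ge0// ltW.
    rewrite ler_pM2l// (le_trans (ler_normB _ _))//.
    by have := sS u; have := sS x; lra.
  have [su0|su0] := eqVneq (s u) 0%R.
    have yr : s x \in r' by rewrite mem_filter sr andbT -su0 eq_sym.
    apply: ler_wpDr; first by rewrite sumr_ge0// => y _; rewrite !mulr_ge0.
    rewrite (big_rem _ yr)/= ler_wpDr//.
      by rewrite sumr_ge0// => y _; rewrite !mulr_ge0.
    by rewrite !indicE !mem_set ?mulr1//= => /eqP; rewrite (negbTE sus).
  have yr : s u \in r' by rewrite mem_filter sr su0.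
  apply: ler_wpDl; first by rewrite sumr_ge0// => y _; rewrite !mulr_ge0.
  rewrite (big_rem _ yr)/= ler_wpDr//.
    by rewrite sumr_ge0// => y _; rewrite !mulr_ge0.
  by rewrite !indicE !mem_set ?mulr1//= => /esym/eqP; rewrite (negbTE sus).
pose rho := (e * A / 2)%R.
have rho0 : (0 < rho)%R by rewrite divr_gt0// mulr_gt0.
have near_tail : \forall w \near F,
    \sum_(i <- [seq inr (true, y) | y <- r'] ++ [seq inr (false, y) | y <- r'])
      transfer mu (a w) (b w) (P i) (Q i) <= rho%:E.
  have small (k : bool) : \forall w \near F,
      \sum_(y <- r') transfer mu (a w) (b w) (P (inr (k, y))) (Q (inr (k, y))) <= (rho / 2)%:E.
    rewrite /r'; under eq_near do rewrite big_filter big_mkcond/=.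
    apply: near_sum_le; last by rewrite divr_gt0.
    move=> y e' e'0; have [y0|y0] := boolP (y != 0%R); last first.
      by apply: nearW => w; rewrite lee_fin ltW.
    have e'C : (0 < e' / (C + 1))%R by rewrite divr_gt0// ltr_wpDl.
    have := leak _ (mE y) (s_fin _ y0) _ e'C.
    apply: filterS2 hab => w [[ha _ _] [hb _ _] _] [l1 l2].
    have ub X : X <= (e' / (C + 1))%:E -> 0 <= X -> C%:E * X <= e'%:E.
      move=> Xe X0; apply: (@le_trans _ _ ((C + 1)%:E * (e' / (C + 1))%:E)).
        by rewrite lee_pmul ?lee_fin// lerDl.
      by rewrite -EFinM mulrC divfK// gt_eqF// ltr_wpDl.
    case: k.
      have := transferZl mu ha hb (hE y) (hEC y) C0.
      by move=> /= ->; apply: (ub _ l1); exact: transfer_ge0.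
    have := transferZl mu ha hb (hEC y) (hE y) C0.
    by move=> /= ->; apply: (ub _ l2); exact: transfer_ge0.
  apply: filterS2 (small true) (small false) => w h1 h2.
  rewrite big_cat !big_map (splitr rho) EFinD.
  exact: (leeD h1 h2).
apply: filterS3 hab tK near_tail => w [adA adB mMB] tKw tail.
apply: (le_trans (modular_le_transfer heta adA adB A0 lam0 mf (t0 w) tKw hP hQ pointwise)).
rewrite lee_pdivrMl// /l !big_cons/= addeA.
apply: (@le_trans _ _ ((B * delta)%:E + (A * delta)%:E + rho%:E)).
  have HE : \int[mu]_x (H x)%:E <= delta%:E by exact: s_delta.
  have I0 : 0 <= \int[mu]_x (H x)%:E.
    by apply: integral_ge0 => x _; rewrite lee_fin; case: hH.
  apply: leeD => //; apply: leeD.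
  - apply: (le_trans (transfer1l adA adB hH)).
    rewrite [leRHS]EFinM lee_pmul// lee_fin//.
    by case: adA adB => _ _ [? _] [_ [? _] _]; rewrite mulr_ge0.
  - apply: (le_trans (transfer1r adA adB hH)).
    by rewrite [leRHS]EFinM lee_wpmul2l// lee_fin ltW.
rewrite -!EFinD -EFinM lee_fin /rho /delta.
have -> : (B * (e * A / (2 * (A + B))) + A * (e * A / (2 * (A + B))) + e * A / 2 = A * e)%R.
  by field; rewrite (gt_eqF AB0).
by [].
Qed.

End ModularConvergence.

(** * Stability of the absence of leaks *)

Section LeakOfSets.
Local Open Scope ereal_scope.
Context d (T : measurableType d) {R : realType}.
Variable mu : {measure set T -> \bar R}.
Implicit Types (a b : nat -> T -> R) (E U V : set T).

(** Declare each index [n] inside or outside [U]: mass of index [n] that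
    crosses the boundary of [U] starts or ends on the side where [n] is not. *)
Lemma transfer_le_deviation a b M m M' m' U (theta : nat -> bool) :
  admissible mu a M m -> admissible mu b M' m' -> measurable U ->
  transfer mu a b \1_U \1_(~` U) <=
  m%:E * \sum_(n <oo) mass mu (b n) (fun x => `| \1_U x - (theta n)%:R|)%R +
  m'%:E * \sum_(n <oo) mass mu (a n) (fun x => `| \1_U x - (theta n)%:R|)%R.
Proof.
move=> adA adB mU; have [ha _ [m0 am]] := adA; have [hb _ [m'0 bm]] := adB.
have hU : nonneg_mfun (\1_U : T -> R) by exact: nonneg_mfun_indic.
have hUC : nonneg_mfun (\1_(~` U) : T -> R).
  by apply: nonneg_mfun_indic; exact: measurableC.
have hD (k : bool) : nonneg_mfun (fun x => `| \1_U x - k%:R : R|)%R.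
  split => //; apply: measurableT_comp => //.
  by apply: measurable_funB; [exact: measurable_indic|exact: measurable_cst].
have h1 : nonneg_mfun (cst 1%R : T -> R) by exact: nonneg_mfun1.
have le1 V x : (\1_V x <= cst 1 x :> R)%R by rewrite indicE; case: (_ \in _).
have D0 b' (hb' : forall n, nonneg_mfun (b' n)) n :
    0 <= mass mu (b' n) (fun x => `| \1_U x - (theta n)%:R|)%R.
  exact: mass_ge0 (hb' n) (hD _).
rewrite -!nneseriesZl; [|by move=> n _; exact: D0..].
rewrite -nneseriesD; last 2 first.
- by move=> n _ _; apply: mule_ge0; [rewrite lee_fin|exact: D0].
- by move=> n _ _; apply: mule_ge0; [rewrite lee_fin|exact: D0].
apply: lee_nneseries => [n _ _|n _]; first by apply: mule_ge0; exact: mass_ge0.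
case: (theta n) (D0 _ ha n) (D0 _ hb n) => da db.
- apply: (@le_trans _ _ (m%:E * mass mu (b n) (fun x => `| \1_U x - 1%:R|)%R)).
    apply: lee_pmul; [exact: mass_ge0|exact: mass_ge0| |].
      apply: le_trans (mass1 n adA).
      exact: le_mass.
    apply: le_mass => //; first exact: (hD true).
    move=> x; rewrite !indicE in_setC.
    by case: (_ \in _); rewrite /= ?subrr ?normr0 ?sub0r ?normrN ?normr1.
  by rewrite leeDl// mule_ge0// lee_fin.
- apply: (@le_trans _ _ (m'%:E * mass mu (a n) (fun x => `| \1_U x - 0%:R|)%R)).
    rewrite muleC; apply: lee_pmul; [exact: mass_ge0|exact: mass_ge0| |].
      apply: le_trans (mass1 n adB).
      exact: le_mass.
    apply: le_mass => //; first exact: (hD false).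
    by move=> x; rewrite subr0 ger0_norm.
  by rewrite leeDr// mule_ge0// lee_fin.
Qed.

Section AlongFilter.
Variables (W : Type) (F : set_system W).
Context {FF : Filter F}.

Definition no_leak (a b : W -> nat -> T -> R) E : Prop :=
  forall e : R, (0 < e)%R ->
  \forall w \near F, transfer mu (a w) (b w) \1_E \1_(~` E) <= e%:E.

Variables (a b : W -> nat -> T -> R) (A B : R) (M m M' m' : W -> R).
Hypothesis hab : \forall w \near F, [/\ admissible mu (a w) (M w) (m w),
  admissible mu (b w) (M' w) (m' w), (M w * m' w <= A)%R & (m w * M' w <= B)%R].
Hypotheses (A0 : (0 <= A)%R) (B0 : (0 <= B)%R).

Let hI E : measurable E -> nonneg_mfun (\1_E : T -> R).
Proof. exact: nonneg_mfun_indic. Qed.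

Let hIC E : measurable E -> nonneg_mfun (\1_(~` E) : T -> R).
Proof. by move=> mE; apply: nonneg_mfun_indic; exact: measurableC. Qed.

Let indic_le (U V : set T) : U `<=` V -> forall x, (\1_U x <= \1_V x :> R)%R.
Proof.
move=> UV x; rewrite !indicE.
have [xU|//] := boolP (x \in U).
by rewrite mem_set//; apply: UV; rewrite -inE.
Qed.

Lemma no_leak0 : no_leak a b set0.
Proof.
move=> e e0; apply: filterS hab => w [[ha _ _] [hb _ _] _ _].
rewrite /transfer eseries0 ?lee_fin ?(ltW e0)// => n _ _.
rewrite [mass _ _ \1_set0]/mass (eq_integral (cst 0)).
  by rewrite integral0 mul0e.
by move=> x _; rewrite indicE in_set0 mulr0.
Qed.

(** Mass that leaves the union leaves one of the two sets. *)
Lemma no_leakU U V : measurable U -> measurable V ->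
  no_leak a b U -> no_leak a b V -> no_leak a b (U `|` V).
Proof.
move=> mU mV lU lV e e0; have e2 : (0 < e / 2)%R by rewrite divr_gt0.
have mUV := measurableU _ _ mU mV.
apply: filterS3 hab (lU _ e2) (lV _ e2) => w [[ha _ _] [hb _ _] _ _] hU hV.
have hUV := nonneg_mfunD (hI mU) (hI mV).
apply: (@le_trans _ _
    (transfer mu (a w) (b w) (fun x => \1_U x + \1_V x)%R \1_(~` (U `|` V)))).
  apply: (le_transfer mu ha hb (hI mUV) hUV (hIC mUV) (hIC mUV)) => // x.
  rewrite !indicE in_setU.
  by case: (x \in U); case: (x \in V); rewrite /= ?addr0 ?add0r// lerDl.
rewrite (transferDl mu ha hb (hI mU) (hI mV) (hIC mUV)).
rewrite (splitr e) EFinD; apply: leeD.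
- apply: le_trans hU.
  apply: (le_transfer mu ha hb (hI mU) (hI mU) (hIC mUV) (hIC mU)) => //.
  by apply: indic_le => x; apply: contra_not; left.
- apply: le_trans hV.
  apply: (le_transfer mu ha hb (hI mV) (hI mV) (hIC mUV) (hIC mV)) => //.
  by apply: indic_le => x; apply: contra_not; right.
Qed.

(** Changing [E] on a set of small measure costs at most the marginals of the
    kernel times that measure. *)
Lemma no_leak_approx E : measurable E ->
  (forall delta : R, (0 < delta)%R -> exists U, [/\ measurable U, no_leak a b U,
     mu (E `\` U) <= delta%:E & mu (U `\` E) <= delta%:E]) ->
  no_leak a b E.
Proof.
move=> mE approx e e0; pose delta := (e / 2 / (A + B + 1))%R.
have S0 : (0 < A + B + 1)%R by rewrite ltr_wpDl// addr_ge0.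
have e2 : (0 < e / 2)%R by rewrite divr_gt0.
have delta0 : (0 < delta)%R by rewrite divr_gt0.
have [U [mU lU EU UE]] := approx _ delta0.
have mEU := measurableD mE mU; have mUE := measurableD mU mE.
have h1 : nonneg_mfun (cst 1%R : T -> R) by exact: nonneg_mfun1.
have le1 V x : (\1_V x <= cst 1 x :> R)%R by rewrite indicE; case: (_ \in _).
have indicI V : measurable V -> \int[mu]_x (\1_V x)%:E = mu V.
  by move=> mV; rewrite integral_indic// setIT.
apply: filterS2 hab (lU _ e2) => w [adA adB Mm mM] lUw.
have [ha _ _] := adA; have [hb _ _] := adB.
have hEUU := nonneg_mfunD (hI mEU) (hI mU).
have hUEU := nonneg_mfunD (hI mUE) (hIC mU).
apply: (@le_trans _ _
    (transfer mu (a w) (b w) (fun x => \1_(E `\` U) x + \1_U x)%R \1_(~` E))).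
  apply: (le_transfer mu ha hb (hI mE) hEUU (hIC mE) (hIC mE)) => // x.
  rewrite !indicE in_setD.
  by case: (x \in U); case: (x \in E); rewrite /= ?addr0 ?add0r.
rewrite (transferDl mu ha hb (hI mEU) (hI mU) (hIC mE)).
apply: (@le_trans _ _ ((A * delta)%:E + ((B * delta)%:E + (e / 2)%:E))).
  apply: leeD.
    apply: (@le_trans _ _ (transfer mu (a w) (b w) \1_(E `\` U) (cst 1%R))).
      exact: (le_transfer mu ha hb (hI mEU) (hI mEU) (hIC mE) h1).
    apply: (le_trans (transfer1r adA adB (hI mEU))).
    rewrite indicI// [leRHS]EFinM lee_pmul// lee_fin//.
    by case: adA adB => _ [? _] _ [_ _ [? _]]; rewrite mulr_ge0.
  rewrite transferC.
  apply: (@le_trans _ _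
      (transfer mu (b w) (a w) (fun x => \1_(U `\` E) x + \1_(~` U) x)%R \1_U)).
    apply: (le_transfer mu hb ha (hIC mE) hUEU (hI mU) (hI mU)) => // x.
    rewrite !indicE in_setD !in_setC.
    by case: (x \in U); case: (x \in E); rewrite /= ?addr0 ?add0r.
  rewrite (transferDl mu hb ha (hI mUE) (hIC mU) (hI mU)); apply: leeD.
    apply: (@le_trans _ _ (transfer mu (b w) (a w) \1_(U `\` E) (cst 1%R))).
      exact: (le_transfer mu hb ha (hI mUE) (hI mUE) (hI mU) h1).
    apply: (le_trans (transfer1r adB adA (hI mUE))).
    rewrite indicI// [leRHS]EFinM lee_pmul//.
      by rewrite lee_fin; case: adA adB => _ _ [? _] [_ [? _] _]; rewrite mulr_ge0.
    by rewrite lee_fin mulrC.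
  by rewrite transferC.
rewrite -!EFinD lee_fin addrA -mulrDl [leRHS]splitr lerD2r.
rewrite /delta mulrCA ler_piMr ?(ltW e2)//.
by rewrite ler_pdivrMr// mul1r lerDl.
Qed.

End AlongFilter.

Lemma integrable_tail (g v : T -> R) (e : R) :
  measurable_fun setT g -> measurable_fun setT v ->
  \int[mu]_x (`|g x|)%:E < +oo -> (0 < e)%R ->
  exists2 L : R, (0 <= L)%R &
    \int[mu]_x (`|g x| * \1_[set x | (L < v x)%R] x)%:E <= e%:E.
Proof.
move=> mg mv goo e0.
have mS (L : R) : measurable [set x | (L < v x)%R].
  rewrite -[X in measurable X]setTI.
  have -> : [set x | (L < v x)%R] = v @^-1` `]L, +oo[.
    by apply/seteqP; split => x /=; rewrite in_itv/= andbT.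
  by apply: mv => //; exact: measurable_itv.
have hg : nonneg_mfun (fun x => `|g x|)%R.
  by split => //; exact: measurableT_comp.
pose G n x := (`|g x| * \1_[set x | ((n%:R : R) < v x)%R] x)%R.
have hG n : nonneg_mfun (G n) by apply: nonneg_mfunM => //; exact: nonneg_mfun_indic.
have lim0 : (fun n => \int[mu]_x (G n x)%:E) @ \oo --> 0.
  have [] := @dominated_convergence _ _ _ mu setT measurableT
    (fun n x => (G n x)%:E) (cst 0) (fun x => (`|g x|)%:E).
  - by move=> n; exact: (nonneg_mfun_EFin (hG n)).
  - exact: measurable_cst.
  - apply: aeW => x _; apply: cvg_near_cst.
    near=> n; rewrite /G indicE memNset ?mulr0//= => /ltW.
    apply/negP; rewrite -ltNge; near: n; exact: nbhs_infty_gtr.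
  - apply/integrableP; split; first exact: (nonneg_mfun_EFin hg).
    by under eq_integral do rewrite gee0_abs//.
  - apply: aeW => x n _; rewrite gee0_abs ?lee_fin; last by case: (hG n).
    by rewrite /G indicE; case: (_ \in _); rewrite ?mulr1 ?mulr0.
  by move=> _ _; rewrite integral0.
have [N _ sN] : \forall n \near \oo, \int[mu]_x (G n x)%:E <= e%:E.
  move/fine_cvgP : lim0 => [fin /cvgr_le/(_ e e0) le_e].
  near=> n; rewrite -[leLHS]fineK ?lee_fin; near: n => //.
by exists N%:R => //; exact: (sN N (leqnn N)).
Unshelve. all: by end_near. Qed.

End LeakOfSets.

(** * Translates on the line and intervals *)

Section TranslatesOnTheLine.
Context {R : realType}.
Local Notation leb := (@completed_lebesgue_measure R).
Local Open Scope ereal_scope.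
Implicit Types (g : R -> R) (w M N : R) (n : nat).

Lemma measurable_borel_completed (A : set (measurableTypeR R)) :
  measurable A -> measurable (A : set (lebR R)).
Proof. by move=> mA; exact: sub_caratheodory. Qed.

Lemma measurable_id_completed : measurable_fun [set: lebR R] (fun x : lebR R => (x : R)).
Proof.
move=> _ Y mY; rewrite setTI.
exact: (measurable_borel_completed mY).
Qed.

Lemma measurable_comp_affine w c g : (0 < w)%R -> measurable_fun [set: lebR R] g ->
  measurable_fun [set: lebR R] (fun x => g (w * x + c)%R).
Proof.
by move=> w0 mg; exact: (measurableT_comp mg (measurable_affine c w0)).
Qed.

Definition translate_abs g w n (x : lebR R) : R :=
  `|g (w * x - (int_of_index n)%:~R)|%R.

Lemma nonneg_mfun_translate_abs g w n : (0 < w)%R ->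
  measurable_fun [set: lebR R] g -> nonneg_mfun (translate_abs g w n).
Proof.
move=> w0 mg; split; last by move=> x; exact: normr_ge0.
exact: (measurableT_comp (@normr_measurable R setT) (measurable_comp_affine _ w0 mg)).
Qed.

Lemma admissible_translate_abs g M N w : (0 < w)%R ->
  measurable_fun [set: lebR R] g -> (0 <= M)%R -> translates_bounded g M ->
  (0 <= N)%R -> \int[leb]_x `|g x|%:E <= N%:E ->
  admissible leb (translate_abs g w) M (w^-1 * N).
Proof.
move=> w0 mg M0 gM N0 gN; split.
- by move=> n; exact: nonneg_mfun_translate_abs.
- split; first exact: M0.
  move=> x; apply: le_trans (gM (w * x)%R).
  by rewrite esum_int_of_index.
- split; first by rewrite mulr_ge0// invr_ge0 ltW.
  move=> n; have hg : measurable_fun [set: lebR R] (fun x => `|g x|%:E).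
    apply/measurable_EFinP.
    exact: (measurableT_comp (@normr_measurable R setT) mg).
  rewrite (ge0_integral_affine (- (int_of_index n)%:~R)%R w0 hg); last first.
    by move=> x; rewrite lee_fin.
  by rewrite EFinM lee_wpmul2l// lee_fin invr_ge0 ltW.
Qed.

Lemma measurable_ocitv (x y : R) : measurable (`]x, y]%classic : set (lebR R)).
Proof. by apply: measurable_borel_completed; exact: measurable_itv. Qed.

(** The mass that the translate |g(w u - k)|, which is centred at k / w, has
    on the other side of the boundary of the interval from its centre, summed
    over k. *)
Definition deviation g w (x y : R) : \bar R :=
  \sum_(n <oo) mass leb (translate_abs g w n) (fun u : lebR R =>
    `| \1_`]x, y]%classic (u : R) -
       ((int_of_index n)%:~R / w \in `]x, y])%:R|)%R.

Let I w (x y : R) : set R := `](w * x)%R, (w * y)%R]%classic.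

Let crossings w (x y : R) n (s : R) : R :=
  (`| \1_(I w x y) ((int_of_index n)%:~R : R) -
      \1_(I w x y) ((int_of_index n)%:~R + s)|)%R.

Let nonneg_mfun_indic_shift w (x y c : R) :
  nonneg_mfun (fun s : lebR R => \1_(I w x y) (c + s)%R : R).
Proof.
have -> : (fun s : lebR R => \1_(I w x y) (c + s)%R : R) =
    \1_(`](w * x - c)%R, (w * y - c)%R]%classic : set (lebR R)).
  apply/funext => s; rewrite !indicE; congr (_%:R); congr nat_of_bool.
  by apply/idP/idP; rewrite !inE/= !in_itv/= ltrBlDr lerBrDr addrC.
by apply: nonneg_mfun_indic; exact: measurable_ocitv.
Qed.

Let nonneg_mfun_crossings w x y n : nonneg_mfun (crossings w x y n : lebR R -> R).
Proof.
split; last by move=> s; exact: normr_ge0.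
apply: (measurableT_comp (@normr_measurable R setT)).
apply: measurable_funB; first exact: measurable_cst.
by have [] := nonneg_mfun_indic_shift w x y (int_of_index n)%:~R.
Qed.

Let sum_crossings_le w (x y s : R) : (0 < w)%R -> (x <= y)%R ->
  \sum_(n <oo) (crossings w x y n s)%:E <=
  (Num.min (4 * `|s| + 2) (2 * (w * y - w * x + 1)))%:E.
Proof.
move=> w0 xy; have wxy : (w * x <= w * y)%R by rewrite ler_wpM2l// ltW.
have := esum_int_itv_shift_le s wxy; rewrite esum_int_of_index//.
Qed.

(** Substitute [w * u = k + s] in the integral of index [k]. *)
Let deviationE g w (x y : R) : (0 < w)%R -> measurable_fun [set: lebR R] g ->
  deviation g w x y = (w^-1)%:E *
    \int[leb]_s (\sum_(n <oo) (`|g s| * crossings w x y n s)%:E).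
Proof.
move=> w0 mg.
have hg : nonneg_mfun (fun s : lebR R => `|g s|%R).
  split; last by move=> s; exact: normr_ge0.
  exact: (measurableT_comp (@normr_measurable R setT) mg).
have hgc n := nonneg_mfunM hg (nonneg_mfun_crossings w x y n).
rewrite (nonneg_integral_series leb hgc).
rewrite -nneseriesZl; last by move=> n _; exact: (nonneg_integral_ge0 leb (hgc n)).
apply: eq_eseriesr => n _.
rewrite -(ge0_integral_affine (- (int_of_index n)%:~R)%R w0 (nonneg_mfun_EFin (hgc n))); last first.
  by move=> s; rewrite lee_fin; case: (hgc n).
apply: eq_integral => u _; congr (_%:E); rewrite /translate_abs; congr (_ * _)%R.
rewrite /crossings distrC; congr (`| _ - _|)%R.
  rewrite indicE /I mem_setE !in_itv/= ltr_pdivlMr// ler_pdivrMr//.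
  by rewrite ![(w * _)%R]mulrC.
by rewrite addrC subrK !indicE /I !mem_setE !in_itv/= ltr_pM2l// ler_pM2l.
Qed.

(** The number of integers that the shift by [s] carries across the boundary
    of an interval of length [w * (y - x)] is negligible before [w] on the
    bounded set [`|s| <= L], and of order [w] at most on the rest, where [g]
    has little mass. *)
Lemma deviation_cvg0 g (x y e : R) : (x <= y)%R ->
  measurable_fun [set: lebR R] g -> \int[leb]_s `|g s|%:E < +oo -> (0 < e)%R ->
  \forall w \near +oo%R, deviation g w x y <= e%:E.
Proof.
move=> xy mg goo e0.
have hg : nonneg_mfun (fun s : lebR R => `|g s|%R).
  split; last by move=> s; exact: normr_ge0.
  exact: (measurableT_comp (@normr_measurable R setT) mg).
have mv : measurable_fun [set: lebR R] (fun s : lebR R => `|s : R|%R).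
  exact: (measurableT_comp (@normr_measurable R setT) measurable_id_completed).
pose l := (y - x + 1)%R; have l0 : (0 < l)%R by rewrite /l; lra.
have e1 : (0 < e / (4 * l))%R by rewrite divr_gt0 ?mulr_gt0.
have [L L0 tail] := integrable_tail mg mv goo e1.
have L2 : (0 <= 4 * L + 2)%R by rewrite addr_ge0// mulr_ge0.
have g0 := nonneg_integral_ge0 leb hg.
pose N := fine (\int[leb]_s `|g s|%:E).
have NE : \int[leb]_s `|g s|%:E = N%:E by rewrite fineK// ge0_fin_numE.
have N0 : (0 <= N)%R by exact: fine_ge0.
have mS : measurable ([set s | (L < `|s : R|)%R] : set (lebR R)).
  rewrite -[X in measurable X]setTI.
  have -> : [set s : lebR R | (L < `|s : R|)%R] = (fun s : lebR R => `|s : R|%R) @^-1` `]L, +oo[.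
    by apply/seteqP; split => z /=; rewrite in_itv/= andbT.
  by apply: mv => //; exact: measurable_itv.
have hS := nonneg_mfun_indic (R := R) mS.
have hgS := nonneg_mfunM hg hS.
near=> w.
have w1 : (1 <= w)%R by near: w; exact: nbhs_pinfty_ge.
have w0 : (0 < w)%R by exact: lt_le_trans w1.
have wN : ((4 * L + 2) * N / (e / 2) <= w)%R.
  by near: w; apply: nbhs_pinfty_ge; exact: num_real.
rewrite deviationE//.
apply: (@le_trans _ _ ((w^-1)%:E * \int[leb]_s ((4 * L + 2) * `|g s| +
   2 * w * l * (`|g s| * \1_[set s : lebR R | (L < `|s : R|)%R] s))%:E)).
  rewrite lee_wpmul2l ?lee_fin ?invr_ge0 ?(ltW w0)//.
  apply: ge0_le_integral_nonmeasurable => s.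
    apply: nneseries_ge0 => n _ _; rewrite lee_fin mulr_ge0//.
    by case: (nonneg_mfun_crossings w x y n).
  under eq_eseriesr do rewrite EFinM.
  rewrite nneseriesZl; last first.
    by move=> n _; rewrite lee_fin; case: (nonneg_mfun_crossings w x y n).
  apply: (le_trans (lee_wpmul2l _ (sum_crossings_le s w0 xy))) => //.
  rewrite -EFinM lee_fin [leLHS]mulrC [(_ * (_ * \1_ _ s))%R]mulrCA.
  rewrite [((4 * L + 2) * _)%R]mulrC -mulrDr mulrC ler_wpM2l//.
  rewrite indicE; have [sL|sL] := leP `|s|%R L.
    rewrite memNset/= ?mulr0 ?addr0; last by apply/negP; rewrite -leNgt.
    rewrite ge_min; apply/orP; left.
    by rewrite lerD2r ler_pM2l.
  rewrite mem_set//= mulr1 ge_min; apply/orP; right.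
  by clear -L0 w0 w1 xy; rewrite /l; lra.
have wl0 : (0 <= 2 * w * l)%R by rewrite !mulr_ge0// ltW.
rewrite (nonneg_integralD leb (nonneg_mfunZ hg L2) (nonneg_mfunZ hgS wl0)).
rewrite (nonneg_integralZ leb hg L2) (nonneg_integralZ leb hgS wl0) NE.
apply: (@le_trans _ _ ((w^-1)%:E * (((4 * L + 2) * N)%:E + (2 * w * l * (e / (4 * l)))%:E))).
  rewrite lee_wpmul2l ?lee_fin ?invr_ge0 ?(ltW w0)// -EFinM leeD2l//.
  by rewrite [leRHS]EFinM lee_wpmul2l// lee_fin.
rewrite -EFinD -EFinM lee_fin ler_pdivrMl//.
have -> : (2 * w * l * (e / (4 * l)) = w * (e / 2))%R by field; rewrite gt_eqF.
rewrite [in leRHS](splitr e) mulrDr lerD2r.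
by rewrite -ler_pdivrMr// divr_gt0.
Unshelve. all: by end_near. Qed.

End TranslatesOnTheLine.

(** * Sets of finite measure and finite unions of intervals *)

Section FiniteUnionsOfIntervals.
Context {R : realType}.
Local Notation leb := (@completed_lebesgue_measure R).
Local Open Scope ereal_scope.

(** Read off the definition of the outer measure: an efficient cover by
    half-open intervals, of which finitely many suffice. *)
Lemma completed_lebesgue_approx (E : set (lebR R)) (e : R) :
  measurable E -> leb E < +oo -> (0 < e)%R ->
  exists (p : nat -> R * R) (n : nat),
    let U := \big[setU/set0]_(k < n) (`](p k).1, (p k).2]%classic : set (lebR R)) in
    leb (E `\` U) <= e%:E /\ leb (U `\` E) <= e%:E.
Proof.
move=> mE Eoo e0.
have Efin : leb E \is a fin_num by rewrite ge0_fin_numE.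
have [_ [F [mF EF] <-] Fe] := lb_ereal_inf_adherent e0 Efin.
have len0 k : 0 <= wlength (@idfun (measurableTypeR R)) (F k).
  exact: wlength_ge0.
have lenE k : leb (F k) = wlength (@idfun (measurableTypeR R)) (F k).
  exact: measurable_mu_extE (mF k).
have mFk k : measurable (F k : set (lebR R)).
  exact: caratheodory_measurable_mu_ext (mF k).
have Fitv k : exists q : R * R, F k = `]q.1, q.2]%classic.
  by have [q _ qF] := mF k; exists q.
pose p k := projT1 (cid (Fitv k)).
have pE k : F k = `](p k).1, (p k).2]%classic := projT2 (cid (Fitv k)).
have sumF : \sum_(k <oo) leb (F k) < leb E + e%:E.
  by under eq_eseriesr do rewrite lenE.
have sumFoo : \sum_(k <oo) leb (F k) < +oo.
  by apply: lt_trans sumF _; rewrite -(fineK Efin) -EFinD ltry.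
have tail : (fun n => \sum_(n <= k <oo) leb (F k)) @ \oo --> 0.
  exact: nneseries_tail_cvg.
have [n _ ne] : \forall n \near \oo, \sum_(n <= k <oo) leb (F k) <= e%:E.
  move/fine_cvgP : tail => [fin /cvgr_le/(_ e e0) le_e].
  near=> n; rewrite -[leLHS]fineK ?lee_fin; near: n => //.
exists p, n; set U := \big[setU/set0]_(k < n) _.
have UE : U = \big[setU/set0]_(k < n) F k.
  by apply: eq_bigr => k _; rewrite pE.
have mU : measurable U by rewrite UE; exact: bigsetU_measurable.
have mbig : measurable (\bigcup_k F k : set (lebR R)) by exact: bigcup_measurable.
have bigle : leb (\bigcup_k F k) <= \sum_(k <oo) leb (F k).
  exact: (measure_sigma_subadditive leb mFk mbig (@subset_refl _ _)).
split.
- apply: (@le_trans _ _ (\sum_(n <= k <oo) leb (F k))); last exact: (ne n (leqnn n)).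
  apply: (measure_sigma_subadditive_tail leb mFk (measurableD mE mU)).
  move=> x [/EF[k _ Fk] Ux]; exists k => //= kn; apply: Ux; rewrite UE.
    by rewrite -bigcup_mkord; exists k.
- apply: (@le_trans _ _ (leb ((\bigcup_k F k) `\` E))).
    apply: le_measure; rewrite ?inE; [exact: measurableD|exact: measurableD|].
    apply: setSD; rewrite UE -bigcup_mkord.
    by apply: bigcup_sub => k _; exact: bigcup_sup.
  rewrite measureD//; last exact: le_lt_trans sumFoo.
  rewrite setIidr// leeBlDr//.
  by rewrite addeC; apply: le_trans (ltW sumF).
Unshelve. all: by end_near. Qed.

End FiniteUnionsOfIntervals.

(** * Translates leak no mass *)

Section NoLeak.
Context {R : realType}.
Local Notation leb := (@completed_lebesgue_measure R).
Local Open Scope ereal_scope.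
Implicit Types (g h : R -> R) (c : R -> R) (w M N : R).

(** In the kernel the translates of [phi] have the factor 1 and those of [psi]
    the factor [w]. The factor is left open because the two families exchange
    their places when the mass that enters a set is considered instead of the
    mass that leaves it. *)
Definition scaled_translates c g w n (x : lebR R) : R :=
  (c w * translate_abs g w n x)%R.

Definition kernel_bounds g M N : Prop :=
  [/\ measurable_fun [set: lebR R] g, (0 < M)%R /\ translates_bounded g M &
      (0 < N)%R /\ \int[leb]_x `|g x|%:E <= N%:E].

Lemma admissible_scaled_translates c g M N w : (0 < w)%R -> (0 < c w)%R ->
  kernel_bounds g M N ->
  admissible leb (scaled_translates c g w) (c w * M) (c w * (w^-1 * N)).
Proof.
move=> w0 c0 [mg [M0 gM] [N0 gN]].
have [ha [_ aM] [m0 am]] :=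
  admissible_translate_abs w0 mg (ltW M0) gM (ltW N0) gN.
split.
- by move=> n; exact: nonneg_mfunZ (ha n) (ltW c0).
- split; first by rewrite mulr_ge0// ltW.
  move=> x; rewrite /scaled_translates; under eq_eseriesr do rewrite EFinM.
  rewrite nneseriesZl; last by move=> n _; rewrite lee_fin; case: (ha n).
  by rewrite EFinM lee_wpmul2l// lee_fin ltW.
- split; first by rewrite mulr_ge0// ltW.
  move=> n; rewrite /scaled_translates (nonneg_integralZ leb (ha n) (ltW c0)).
  by rewrite EFinM lee_wpmul2l// lee_fin ltW.
Qed.

Variables (c1 c2 : R -> R) (g h : R -> R) (Mg Ng Mh Nh : R).
Hypothesis c12 : forall w, (0 < w)%R ->
  [/\ (0 < c1 w)%R, (0 < c2 w)%R & (c1 w * c2 w = w)%R].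
Hypotheses (hg : kernel_bounds g Mg Ng) (hh : kernel_bounds h Mh Nh).

Let a := scaled_translates c1 g.
Let b := scaled_translates c2 h.

Let near_admissible : \forall w \near +oo%R,
  [/\ admissible leb (a w) (c1 w * Mg) (c1 w * (w^-1 * Ng)),
      admissible leb (b w) (c2 w * Mh) (c2 w * (w^-1 * Nh)),
      (c1 w * Mg * (c2 w * (w^-1 * Nh)) <= Mg * Nh)%R &
      (c1 w * (w^-1 * Ng) * (c2 w * Mh) <= Ng * Mh)%R].
Proof.
near=> w.
have w0 : (0 < w)%R by near: w; apply: nbhs_pinfty_gt; exact: num_real.
have [c10 c20 cw] := c12 w0.
split.
- exact: admissible_scaled_translates.
- exact: admissible_scaled_translates.
- have -> : (c1 w * Mg * (c2 w * (w^-1 * Nh)) = (c1 w * c2 w) / w * (Mg * Nh))%R by ring.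
  by rewrite cw divff ?gt_eqF// mul1r.
- have -> : (c1 w * (w^-1 * Ng) * (c2 w * Mh) = (c1 w * c2 w) / w * (Ng * Mh))%R by ring.
  by rewrite cw divff ?gt_eqF// mul1r.
Unshelve. all: by end_near. Qed.

Let sum_deviation c g' M N w (x y : R) : (0 < w)%R -> (0 < c w)%R ->
  kernel_bounds g' M N ->
  \sum_(n <oo) mass leb (scaled_translates c g' w n) (fun u : lebR R =>
    `| \1_(`]x, y]%classic : set (lebR R)) u -
       ((int_of_index n)%:~R / w \in `]x, y])%:R|)%R =
  (c w)%:E * deviation g' w x y.
Proof.
move=> w0 c0 [mg _ _].
have hD n : nonneg_mfun (fun u : lebR R => `| \1_(`]x, y]%classic : set (lebR R)) u -
       ((int_of_index n)%:~R / w \in `]x, y])%:R : R|)%R.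
  split; last by move=> u; exact: normr_ge0.
  apply: (measurableT_comp (@normr_measurable R setT)).
  apply: measurable_funB; last exact: measurable_cst.
  by have [] := nonneg_mfun_indic (R := R) (measurable_ocitv x y).
have hT n := nonneg_mfun_translate_abs n w0 mg.
rewrite /deviation -nneseriesZl; last by move=> n _; exact: mass_ge0.
apply: eq_eseriesr => n _.
rewrite /mass -(nonneg_integralZ leb (nonneg_mfunM (hT n) (hD n)) (ltW c0)).
by apply: eq_integral => u _; rewrite /scaled_translates mulrA.
Qed.

Lemma no_leak_ocitv (x y : R) :
  no_leak leb (nbhs +oo%R) a b (`]x, y]%classic : set (lebR R)).
Proof.
have [xy|yx] := leP x y; last first.
  have -> : `]x, y]%classic = set0 :> set R.
    by rewrite set_itv_ge// bnd_simp -leNgt ltW.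
  exact: (no_leak0 near_admissible).
move=> e e0; have [mg _ [Ng0 gN]] := hg; have [mh _ [Nh0 hN]] := hh.
have goo : \int[leb]_s `|g s|%:E < +oo by apply: le_lt_trans gN _; rewrite ltry.
have hoo : \int[leb]_s `|h s|%:E < +oo by apply: le_lt_trans hN _; rewrite ltry.
have e1 : (0 < e / (2 * Ng))%R by apply: divr_gt0 => //; exact: mulr_gt0.
have e2 : (0 < e / (2 * Nh))%R by apply: divr_gt0 => //; exact: mulr_gt0.
near=> w.
have w0 : (0 < w)%R by near: w; apply: nbhs_pinfty_gt; exact: num_real.
have [c10 c20 cw] := c12 w0.
have dh : deviation h w x y <= (e / (2 * Ng))%:E.
  by near: w; exact: deviation_cvg0.
have dg : deviation g w x y <= (e / (2 * Nh))%:E.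
  by near: w; exact: deviation_cvg0.
have adA := admissible_scaled_translates w0 c10 hg.
have adB := admissible_scaled_translates w0 c20 hh.
apply: (le_trans (transfer_le_deviation
  (fun n => (int_of_index n)%:~R / w \in `]x, y])%R adA adB (measurable_ocitv x y))).
have := sum_deviation x y w0 c10 hg; rewrite -/a => ->.
have := sum_deviation x y w0 c20 hh; rewrite -/b => ->.
rewrite !muleA -!EFinM.
have -> : (c1 w * (w^-1 * Ng) * c2 w = (c1 w * c2 w) / w * Ng)%R by ring.
have -> : (c2 w * (w^-1 * Nh) * c1 w = (c1 w * c2 w) / w * Nh)%R by ring.
rewrite cw divff ?gt_eqF// !mul1r (splitr e) EFinD.
apply: leeD.
- apply: (@le_trans _ _ (Ng%:E * (e / (2 * Ng))%:E)).
    by rewrite lee_wpmul2l// lee_fin ltW.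
  rewrite -EFinM lee_fin.
  by have -> : (Ng * (e / (2 * Ng)) = e / 2)%R by field; rewrite gt_eqF.
- apply: (@le_trans _ _ (Nh%:E * (e / (2 * Nh))%:E)).
    by rewrite lee_wpmul2l// lee_fin ltW.
  rewrite -EFinM lee_fin.
  by have -> : (Nh * (e / (2 * Nh)) = e / 2)%R by field; rewrite gt_eqF.
Unshelve. all: by end_near. Qed.

Lemma no_leak_translates (E : set (lebR R)) : measurable E -> leb E < +oo ->
  no_leak leb (nbhs +oo%R) a b E.
Proof.
move=> mE Eoo; have [_ [Mg0 _] [Ng0 _]] := hg; have [_ [Mh0 _] [Nh0 _]] := hh.
have A0 : (0 <= Mg * Nh)%R by rewrite mulr_ge0// ltW.
have B0 : (0 <= Ng * Mh)%R by rewrite mulr_ge0// ltW.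
apply: (no_leak_approx near_admissible A0 B0 mE) => delta delta0.
have [p [n [EU UE]]] := completed_lebesgue_approx mE Eoo delta0.
exists (\big[setU/set0]_(k < n) (`](p k).1, (p k).2]%classic : set (lebR R))).
have mp k : measurable (`](p k).1, (p k).2]%classic : set (lebR R)).
  exact: measurable_ocitv.
split.
- by apply: bigsetU_measurable.
- elim: n {EU UE} => [|n IH].
    by rewrite big_ord0; exact: (no_leak0 near_admissible).
  rewrite big_ord_recr.
  apply: (no_leakU near_admissible _ (mp n) IH (no_leak_ocitv _ _)).
  exact: bigsetU_measurable.
- exact: EU.
- exact: UE.
Qed.

End NoLeak.

(** * Weighted means of functions of an Orlicz space *)

Section WeightedMeans.
Local Open Scope ereal_scope.
Context d (T : measurableType d) {R : realType}.
Variable mu : {measure set T -> \bar R}.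
Implicit Types (g f : T -> R).

Lemma integrable_EFinP g : mu.-integrable setT (EFin \o g) <->
  measurable_fun setT g /\ \int[mu]_u `|g u|%:E < +oo.
Proof.
split.
  by move=> /integrableP[mg goo]; split => //; exact/measurable_EFinP.
by move=> [mg goo]; apply/integrableP; split => //; exact/measurable_EFinP.
Qed.

Let nonneg_norm g : measurable_fun setT g -> nonneg_mfun (fun u => `|g u|)%R.
Proof. by move=> mg; split => //; exact: measurableT_comp. Qed.

(** A bounded integrable function pairs with the whole Orlicz space because
    [c * |f| <= 1 + eta (c * |f|) / eta 1]. *)
Lemma orlicz_pairing_le eta (heta : convex_phi_function eta) g f (M c : R) :
  measurable_fun setT g -> (0 <= M)%R -> (forall u, `|g u| <= M)%R -> (0 < c)%R ->
  measurable_fun setT f ->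
  \int[mu]_u `|(g u * f u)%R|%:E <= (c^-1)%:E *
    (\int[mu]_u `|g u|%:E + (M / eta 1)%:E * \int[mu]_u (eta (c * `|f u|))%:E).
Proof.
move=> mg M0 gM c0 mf.
have e1 : (0 < eta 1)%R by case: heta => _ _; apply.
have hf := nonneg_mfun_eta heta (ltW c0) mf.
have M1 : (0 <= M / eta 1)%R by rewrite divr_ge0// ltW.
have ci0 : (0 <= c^-1)%R by rewrite invr_ge0 ltW.
have hgM := nonneg_mfunZ hf M1.
rewrite -(nonneg_integralZ mu hf M1) -(nonneg_integralD mu (nonneg_norm mg) hgM).
rewrite -(nonneg_integralZ mu (nonneg_mfunD (nonneg_norm mg) hgM) ci0).
apply: ge0_le_integral_nonmeasurable => u; rewrite lee_fin//.
rewrite ler_pdivlMl// normrM.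
have cf0 : (0 <= c * `|f u|)%R by rewrite mulr_ge0// ltW.
apply: (@le_trans _ _ (`|g u| * (1 + eta (c * `|f u|) / eta 1))%R).
  by rewrite mulrCA ler_wpM2l// (phi_function_linear_growth heta).
rewrite mulrDr mulr1 lerD2l mulrA [leRHS]mulrAC ler_pM2r ?invr_gt0//.
by rewrite ler_wpM2r// (phi_function_ge0 heta).
Qed.

(** As [w * g] has integral 1, [y] can be brought inside the integral. *)
Lemma weighted_mean_deviation g f (w y : R) : (0 <= w)%R ->
  mu.-integrable setT (EFin \o g) ->
  mu.-integrable setT (EFin \o (fun u => g u * f u)%R) ->
  measurable_fun setT f -> (w * \int[mu]_u g u = 1)%R ->
  `|(w * \int[mu]_u (g u * f u) - y)%R|%:E <=
  mass mu (fun u => w * `|g u|)%R (fun u => `|f u - y|)%R.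
Proof.
move=> w0 ig igf mf wg.
have iwgf : mu.-integrable setT (EFin \o (fun u => w * (g u * f u))%R).
  by have := integrableZl measurableT w igf; apply: eq_integrable.
have iyg : mu.-integrable setT (EFin \o (fun u => y * w * g u)%R).
  by have := integrableZl measurableT (y * w)%R ig; apply: eq_integrable.
have -> : (w * \int[mu]_u (g u * f u) - y =
    \int[mu]_u (w * (g u * f u) - y * w * g u))%R.
  by rewrite RintegralB// !RintegralZl// -mulrA wg mulr1.
have ib : mu.-integrable setT
    (EFin \o (fun u => w * (g u * f u) - y * w * g u)%R).
  by have := integrableB measurableT iwgf iyg; apply: eq_integrable.
rewrite EFin_normr_Rintegral//.
apply: (le_trans (le_abse_integral mu measurableT _)).
  by move/integrableP : ib => [].
apply: ge0_le_integral_nonmeasurable => u //=.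
rewrite lee_fin.
have -> : (w * (g u * f u) - y * w * g u = w * g u * (f u - y))%R by ring.
by rewrite !normrM (ger0_norm w0).
Qed.

End WeightedMeans.

(** * The operator *)

Section Durrmeyer.
Context {R : realType}.
Local Notation leb := (@completed_lebesgue_measure R).
Local Open Scope ereal_scope.
Implicit Types (g phi psi f : R -> R) (w c x : R).

Lemma integral_affine w c (h : lebR R -> \bar R) : (0 < w)%R ->
  leb.-integrable [set: lebR R] h ->
  \int[leb]_x h (w * x + c)%R = (w^-1)%:E * \int[leb]_x h x.
Proof.
move=> w0 ih; have [mh hoo] := integrableP _ _ _ ih.
have hp := integrable_pos_fin_num measurableT ih.
have hn := integrable_neg_fin_num measurableT ih.
rewrite [LHS]integralE [in RHS]integralE muleBr ?fin_num_adde_defr//.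
congr (_ - _).
- rewrite -(ge0_integral_affine c w0 (measurable_funepos mh) (funepos_ge0 h)).
  by apply: eq_integral => u _; rewrite !funeposE.
- rewrite -(ge0_integral_affine c w0 (measurable_funeneg mh) (funeneg_ge0 h)).
  by apply: eq_integral => u _; rewrite !funenegE.
Qed.

Lemma in_L1_affine w c g : (0 < w)%R -> in_L1 g ->
  in_L1 (fun u => g (w * u + c)%R) /\
  (w * (\int[leb]_u g (w * u + c)) = \int[leb]_u g u)%R.
Proof.
move=> w0 ig; have [mg goo] := (integrable_EFinP leb g).1 ig.
have hg : measurable_fun [set: lebR R] (fun x => `|g x|%:E).
  by apply/measurable_EFinP; exact: (measurableT_comp (@normr_measurable R setT) mg).
split.
  apply/(integrable_EFinP leb _); split; first exact: measurable_comp_affine.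
  rewrite (ge0_integral_affine c w0 hg); last by move=> x; rewrite lee_fin.
  by rewrite lte_mul_pinfty// lee_fin invr_ge0 ltW.
have := integral_affine c w0 ig; rewrite /Rintegral => -> /=.
rewrite fineM//; last exact: (integrable_fin_num measurableT ig).
by rewrite /= mulrA mulfV ?gt_eqF// mul1r.
Qed.

Section Operator.
Variables (phi psi eta f : R -> R) (Mphi Nphi Mpsi Npsi c : R).
Hypothesis heta : convex_phi_function eta.
Hypothesis hphi : kernel_bounds phi Mphi Nphi.
Hypothesis hpsi : kernel_bounds psi Mpsi Npsi.
Hypothesis phi1 : forall u : R, cvg_sumZ (fun k => phi (u - k%:~R)%R) /\
  sumZ (fun k => phi (u - k%:~R)%R) = 1%R.
Hypothesis psi1 : (\int[leb]_u psi u = 1)%R.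
Hypotheses (c0 : (0 < c)%R) (mf : measurable_fun [set: lebR R] f).
Hypothesis foo : \int[leb]_x (eta (c * `|f x|))%:E < +oo.

Let psiL1 : in_L1 psi.
Proof.
have [mpsi _ [_ psiN]] := hpsi; apply/(integrable_EFinP leb _); split => //.
by apply: le_lt_trans psiN _; rewrite ltry.
Qed.

(** A bound on the mean values of [f] against [psi] that is uniform in [k]. *)
Let pairing_bound w : (0 < w)%R -> exists2 D : R, (0 <= D)%R &
  forall k : int, in_L1 (fun u => psi (w * u - k%:~R) * f u)%R /\
    \int[leb]_u `|(psi (w * u - k%:~R) * f u)%R|%:E <= D%:E.
Proof.
move=> w0; have [mpsi [Mpsi0 psiM] [Npsi0 psiN]] := hpsi.
have hf := nonneg_mfun_eta heta (ltW c0) mf.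
pose If := fine (\int[leb]_x (eta (c * `|f x|))%:E).
have IfE : \int[leb]_x (eta (c * `|f x|))%:E = If%:E.
  by rewrite fineK// ge0_fin_numE//; exact: (nonneg_integral_ge0 leb hf).
have If0 : (0 <= If)%R by apply: fine_ge0; exact: (nonneg_integral_ge0 leb hf).
have e1 : (0 < eta 1)%R by case: heta => _ _; apply.
pose D := (c^-1 * (w^-1 * Npsi + Mpsi / eta 1 * If))%R.
have D0 : (0 <= D)%R.
  by rewrite mulr_ge0 ?invr_ge0 ?(ltW c0)// addr_ge0// mulr_ge0// ?divr_ge0 ?invr_ge0 ?ltW.
exists D => // k.
have mpk := measurable_comp_affine (- k%:~R)%R w0 mpsi.
have pk : \int[leb]_u `|psi (w * u - k%:~R)%R|%:E <= (w^-1 * Npsi)%:E.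
  have hg : measurable_fun [set: lebR R] (fun x => `|psi x|%:E).
    by apply/measurable_EFinP; exact: (measurableT_comp (@normr_measurable R setT) mpsi).
  rewrite (ge0_integral_affine (- k%:~R)%R w0 hg); last by move=> x; rewrite lee_fin.
  by rewrite EFinM lee_wpmul2l// lee_fin invr_ge0 ltW.
have bound : \int[leb]_u `|(psi (w * u - k%:~R) * f u)%R|%:E <= D%:E.
  apply: (le_trans (orlicz_pairing_le leb heta mpk (ltW Mpsi0)
    (fun u => translates_bounded_norm _ psiM) c0 mf)).
  rewrite /D [leRHS]EFinM lee_wpmul2l ?lee_fin ?invr_ge0 ?(ltW c0)// EFinD.
  by apply: leeD => //; rewrite IfE -EFinM.
split => //; apply/(integrable_EFinP leb _); split.
  exact: (measurable_funM mpk mf).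
by apply: le_lt_trans bound _; rewrite ltry.
Qed.

(** The mean values of [f] are bounded and the translates of [phi] are
    absolutely summable. *)
Lemma durrmeyer_domP w : (0 < w)%R -> durrmeyer_dom phi psi w f.
Proof.
move=> w0; have [D D0 hD] := pairing_bound w0.
split=> [k|x]; first by have [] := hD k.
have [_ [Mphi0 phiM] _] := hphi.
apply: cvg_sumZ_abs.
apply: (@le_lt_trans _ _ ((w * D)%:E * Mphi%:E)); last by rewrite -EFinM ltry.
apply: (@le_trans _ _ ((w * D)%:E *
    \esum_(k in [set: int]) `|phi (w * x - k%:~R)%R|%:E)); last first.
  by rewrite lee_wpmul2l// lee_fin mulr_ge0// ltW.
rewrite !esum_int_of_index// -nneseriesZl//.
apply: lee_nneseries => n // _.
have [ik kD] := hD (int_of_index n).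
rewrite -EFinM lee_fin /durrmeyer_term normrM mulrC ler_wpM2r//.
rewrite normrM gtr0_norm// ler_pM2l// -lee_fin.
rewrite (EFin_normr_Rintegral measurableT ik).
have [mk _] := integrableP _ _ _ ik.
exact: (le_trans (le_abse_integral leb measurableT mk) kD).
Qed.

(** As the translates of [phi] sum to 1, [f x] can be brought inside the
    series, and then inside each mean value. *)
Lemma durrmeyer_deviation_le w x : (0 < w)%R ->
  `|(durrmeyer phi psi w f x - f x)%R|%:E <=
  \int[leb]_u (kernel_of (scaled_translates (cst 1%R) phi w)
     (scaled_translates id psi w) x u * (`|f u - f x|)%:E).
Proof.
move=> w0; have [mphi _ _] := hphi; have [mpsi _ _] := hpsi.
have hA n : nonneg_mfun (scaled_translates (cst 1%R) phi w n).
  exact: nonneg_mfunZ (nonneg_mfun_translate_abs n w0 mphi) ler01.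
have hB n : nonneg_mfun (scaled_translates id psi w n).
  exact: nonneg_mfunZ (nonneg_mfun_translate_abs n w0 mpsi) (ltW w0).
have hfx : nonneg_mfun (fun u : lebR R => `|f u - f x|)%R.
  split; last by move=> u; exact: normr_ge0.
  apply: (measurableT_comp (@normr_measurable R setT)).
  by apply: measurable_funB => //; exact: measurable_cst.
rewrite (integral_kernel_of leb hA hB x hfx).
have [_ domx] := durrmeyer_domP w0.
have [phic phi1x] := phi1 (w * x).
have -> : (durrmeyer phi psi w f x - f x = sumZ (fun k =>
    durrmeyer_term phi psi w f x k - phi (w * x - k%:~R) * f x))%R.
  by rewrite (sumZB (f x) (domx x) phic) phi1x mul1r.
apply: (le_trans (abs_sumZ_le _)); rewrite esum_int_of_index//.
apply: lee_nneseries => n //= _.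
rewrite /durrmeyer_term -mulrBr normrM EFinM.
rewrite /scaled_translates /translate_abs /= mul1r.
rewrite lee_wpmul2l//.
have [ipsi psik] := in_L1_affine (- (int_of_index n)%:~R)%R w0 psiL1.
rewrite psi1 in psik.
have [ik _] := durrmeyer_domP w0.
exact: (weighted_mean_deviation (f x) (ltW w0) ipsi (ik (int_of_index n)) mf psik).
Qed.

End Operator.

End Durrmeyer.

(** * Modular convergence *)

Local Notation leb := (@completed_lebesgue_measure _).

Theorem theorem4p3 (R : realType) (phi psi eta f : R -> R)
    (hker : kernel_pair phi psi)
    (hpsi : (abs_moment 0 psi < +oo)%E)
    (heta : convex_phi_function eta)
    (hf : orlicz_space eta f) :
  (forall w : R, 0 < w -> durrmeyer_dom phi psi w f) /\
  exists2 lambda : R, 0 < lambda &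
    modular eta (fun x => lambda * (durrmeyer phi psi w f x - f x))
      @[w --> +oo] --> 0%E.
Proof.
case: hker => [[phiL1 psiL1] phib phi1 psi1 [r r0 phir]].
case: hf => mf [c c0 foo].
have [Mphi Mphi0 hMphi] := translates_bounded_moment phib r0 phir.
have [Mpsi Mpsi0 hMpsi] := translates_bounded_moment0 hpsi.
have bounds (g : R -> R) (M : R) : in_L1 g -> 0 < M -> translates_bounded g M ->
    exists N, kernel_bounds g M N.
  move=> /(integrable_EFinP leb g).1 [mg goo] M0 gM.
  have g0 : (0 <= \int[leb]_x `|g x|%:E)%E by apply: integral_ge0.
  exists (fine (\int[leb]_x `|g x|%:E)%E + 1); split => //.
  split; first by rewrite ltr_wpDl// fine_ge0.
  by rewrite EFinD fineK ?ge0_fin_numE// leeDl.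
have [Nphi hphi] := bounds _ _ phiL1 Mphi0 hMphi.
have [Npsi hps] := bounds _ _ psiL1 Mpsi0 hMpsi.
have Nphi0 : 0 < Nphi by case: hphi => _ _ [].
have Npsi0 : 0 < Npsi by case: hps => _ _ [].
have foo' : (\int[leb]_x (eta (c * `|f x|))%:E < +oo)%E.
  apply: le_lt_trans foo; rewrite le_eqVlt; apply/predU1P; left.
  by apply: eq_integral => x _; rewrite normrM gtr0_norm.
have dom := durrmeyer_domP heta hphi hps c0 mf foo'.
split; first exact: dom.
have A0 : 0 < Mphi * Npsi by rewrite mulr_gt0.
have B0 : 0 <= Nphi * Mpsi by rewrite mulr_ge0// ltW.
(* Jensen's inequality costs the factor [Mphi * Npsi], and splitting
   [f u - f x] into three differences costs the factor 3. *)
pose lam := c / (3 * (Mphi * Npsi)).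
have lam0 : 0 < lam by rewrite divr_gt0// mulr_gt0.
exists lam => //.
pose t w x : R := `|durrmeyer phi psi w f x - f x|.
have small (e : R) : 0 < e -> \forall w \near +oo,
    (\int[leb]_x (eta (lam * t w x))%:E <= e%:E)%E.
  apply: (@modular_approximation _ _ _ leb eta heta R (nbhs +oo) _
    (scaled_translates (cst 1) phi) (scaled_translates id psi) Mphi Npsi
    (fun w => w^-1 * Nphi) (fun w => w * Mpsi) (Nphi * Mpsi) f t c) => //.
  - near=> w.
    have w0 : 0 < w by near: w; apply: nbhs_pinfty_gt; exact: num_real.
    split.
    + have := admissible_scaled_translates (c := cst 1) w0 ltr01 hphi.
      by rewrite /= !mul1r.
    + have wN0 : w != 0 by rewrite gt_eqF.
      rewrite -[Npsi](mulVKf wN0).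
      exact: (admissible_scaled_translates (c := id) w0 w0 hps).
    + by rewrite mulrACA mulVf ?gt_eqF// mul1r.
  - by move=> w x; exact: normr_ge0.
  - have pos : \forall w \near +oo, 0 < w :> R.
      by apply: nbhs_pinfty_gt; exact: num_real.
    apply: filterS pos => w w0 x.
    exact: (durrmeyer_deviation_le heta hphi hps phi1 psi1 c0 mf foo').
  - move=> E mE Eoo d d0.
    have c1i (w : R) : 0 < w -> [/\ 0 < cst 1 w :> R, 0 < id w & cst 1 w * id w = w].
      by move=> w0; split => //=; rewrite mul1r.
    have ci1 (w : R) : 0 < w -> [/\ 0 < id w, 0 < cst 1 w :> R & id w * cst 1 w = w].
      by move=> w0; split => //=; rewrite mulr1.
    have l1 := no_leak_translates c1i hphi hps mE Eoo d0.
    have l2 := no_leak_translates ci1 hps hphi mE Eoo d0.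
    apply: filterS2 l1 l2 => w h1 h2; split; first exact: h1.
    by rewrite transferC; exact: h2.
have modE w : modular eta (fun x => lam * (durrmeyer phi psi w f x - f x)) =
    (\int[leb]_x (eta (lam * t w x))%:E)%E.
  by apply: eq_integral => x _; rewrite normrM gtr0_norm.
have mod0 w : (0 <= \int[leb]_x (eta (lam * t w x))%:E)%E.
  apply: integral_ge0 => x _; rewrite lee_fin (phi_function_ge0 heta)//.
  exact: mulr_ge0 (ltW lam0) (normr_ge0 _).
under eq_fun do rewrite modE.
apply/fine_cvgP; split.
  apply: filterS (small 1 ltr01) => w h.
  by rewrite ge0_fin_numE//; apply: le_lt_trans h _; rewrite ltry.
apply/cvgrPdist_le => e e0; apply: filterS (small e e0) => w h.
have fin : (\int[leb]_x (eta (lam * t w x))%:E)%E \is a fin_num.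
  by rewrite ge0_fin_numE//; apply: le_lt_trans h _; rewrite ltry.
by rewrite sub0r normrN ger0_norm ?fine_ge0// -lee_fin fineK.
Unshelve. all: by end_near. Qed.
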